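(* Let $G_m$ be a bounded Vilenkin group and let $\varphi:P_+\to[1,\infty)$ be a nondecreasing function such that $$\limsup_{n\to\infty}\frac{\log^2(n+1)}{\varphi(n)}=+\infty .$$ Then there exists a martingale $f\in H_{1/2}(G_m)$ such that $$\sup_{n\in P_+}\Big\|\frac{\sigma_nf}{\varphi(n)}\Big\|_{L_{1/2}(G_m)}=\infty .$$
   Context: Let $P_+$ be the positive integers and $P=P_+\cup\{0\}$. Let $m=(m_0,m_1,\dots)$ be a sequence of integers $m_k\ge 2$ with $\sup_k m_k<\infty$ (bounded Vilenkin group). $G_m$ is the complete direct product of the cyclic groups $Z_{m_k}=\{0,1,\dots,m_k-1\}$, with Haar measure $\mu$ = product of the uniform probability measures on $Z_{m_k}$; elements are $x=(x_0,x_1,\dots)$. Put $M_0=1$, $M_{k+1}=m_kM_k$. For $x\in G_m$, $I_n(x)=\{y: y_j=x_j,\ 0\le j<n\}$. Every $n\in P$ is written uniquely as $n=\sum_j n_jM_j$ with $n_j\in Z_{m_j}$. Rademacher functions $r_k(x)=\exp(2\pi i x_k/m_k)$; Vilenkin system $\psi_n=\prod_k r_k^{n_k}$. Let $\mathcal F_n$ be the $\sigma$-algebra generated by the sets $I_n(x)$. For a martingale $f=(f^{(n)})_{n\in P}$ with respect to $(\mathcal F_n)$, $f^*=\sup_n|f^{(n)}|$, and for $0<p<\infty$ the Hardy space $H_p(G_m)$ consists of martingales with $\|f\|_{H_p}:=\|f^*\|_{L_p}<\infty$, where $\|g\|_{L_p}=(\int_{G_m}|g|^pd\mu)^{1/p}$.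 Fourier coefficients of a martingale: $\hat f(i)=\lim_{k\to\infty}\int_{G_m}f^{(k)}\overline{\psi_i}\,d\mu$. Partial sums $S_nf=\sum_{k=0}^{n-1}\hat f(k)\psi_k$ ($S_0f=0$), Fejér means $\sigma_nf=\frac1n\sum_{k=0}^{n-1}S_kf$ ($n\in P_+$). $\log$ denotes a fixed logarithm. *)

(* Defs.v *)
From Stdlib Require Import Reals Lra Lia List ClassicalEpsilon.
Import ListNotations.
Open Scope R_scope.

Definition Cx := (R * R)%type.
Definition C0 : Cx := (0, 0).
Definition C1 : Cx := (1, 0).
Definition Cadd (z w : Cx) : Cx := (fst z + fst w, snd z + snd w).
Definition Cmul (z w : Cx) : Cx :=
  (fst z * fst w - snd z * snd w, fst z * snd w + snd z * fst w).
Definition Cconj (z : Cx) : Cx := (fst z, - snd z).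
Definition Cscal (a : R) (z : Cx) : Cx := (a * fst z, a * snd z).
Definition Cnorm (z : Cx) : R := sqrt (fst z ^ 2 + snd z ^ 2).
Fixpoint Cpow (z : Cx) (n : nat) : Cx :=
  match n with O => C1 | S n => Cmul z (Cpow z n) end.
Definition Cexpi (t : R) : Cx := (cos t, sin t).
Definition Csum (n : nat) (F : nat -> Cx) : Cx := fold_right Cadd C0 (map F (seq 0 n)).
Definition Cprod (n : nat) (F : nat -> Cx) : Cx := fold_right Cmul C1 (map F (seq 0 n)).
Definition Ccv (u : nat -> Cx) (c : Cx) : Prop :=
  Un_cv (fun k => fst (u k)) (fst c) /\ Un_cv (fun k => snd (u k)) (snd c).

Definition inG (m : nat -> nat) (x : nat -> nat) : Prop := forall k, (x k < m k)%nat.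

Fixpoint Mk (m : nat -> nat) (k : nat) : nat :=
  match k with O => 1%nat | S k => (m k * Mk m k)%nat end.

Definition digit (m : nat -> nat) (n j : nat) : nat := ((n / Mk m j) mod m j)%nat.

Definition rad (m : nat -> nat) (k : nat) (x : nat -> nat) : Cx :=
  Cexpi (2 * PI * INR (x k) / INR (m k)).

(* Vilenkin functions psi_n = prod_k r_k^{n_k}; digits n_k vanish for k > n
   (since M_k >= 2^k), so the product over k <= n is the full product. *)
Definition psi (m : nat -> nat) (n : nat) (x : nat -> nat) : Cx :=
  Cprod (S n) (fun k => Cpow (rad m k x) (digit m n k)).

Fixpoint tuples (m : nat -> nat) (L : nat) : list (list nat) :=
  match L with
  | O => [[]]
  | S L => flat_map (fun t => map (fun a => t ++ [a]) (seq 0 (m L))) (tuples m L)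
  end.
Definition ext (t : list nat) : nat -> nat := fun k => nth k t 0%nat.

(* Haar integral of a function that depends only on the first L coordinates
   (i.e. an F_L-measurable function): average over the M_L cosets I_L(x). *)
Definition integral_lvl (m : nat -> nat) (L : nat) (g : (nat -> nat) -> R) : R :=
  fold_right Rplus 0 (map (fun t => g (ext t)) (tuples m L)) / INR (Mk m L).
Definition Cintegral_lvl (m : nat -> nat) (L : nat) (g : (nat -> nat) -> Cx) : Cx :=
  (integral_lvl m L (fun x => fst (g x)), integral_lvl m L (fun x => snd (g x))).

Definition measurable_lvl (m : nat -> nat) (L : nat) (g : (nat -> nat) -> Cx) : Prop :=
  forall x y, inG m x -> inG m y -> (forall j, (j < L)%nat -> x j = y j) -> g x = g y.

Definition upd (x : nat -> nat) (n a : nat) : nat -> nat :=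
  fun k => if Nat.eqb k n then a else x k.

(* martingale w.r.t. (F_n): f^(n) is F_n-measurable and E(f^(n+1) | F_n) = f^(n) *)
Definition is_martingale (m : nat -> nat) (f : nat -> (nat -> nat) -> Cx) : Prop :=
  (forall n, measurable_lvl m n (f n)) /\
  (forall n x, inG m x ->
     f n x = Cscal (/ INR (m n)) (Csum (m n) (fun a => f (S n) (upd x n a)))).

Fixpoint maxupto (N : nat) (h : nat -> R) : R :=
  match N with O => h O | S N => Rmax (maxupto N h) (h (S N)) end.

(* f in H_{1/2}: int (f-star)^{1/2} < oo, with f-star = sup_n |f^(n)|.  By monotone
   convergence int (f-star)^{1/2} = sup_N int (max_{n<=N} |f^(n)|)^{1/2}, and the
   latter integrands are F_N-measurable. *)
Definition in_H_half (m : nat -> nat) (f : nat -> (nat -> nat) -> Cx) : Prop :=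
  is_martingale m f /\
  exists B, forall N,
    integral_lvl m N (fun x => sqrt (maxupto N (fun n => Cnorm (f n x)))) <= B.

(* Fourier coefficients: hat f(i) = lim_k int f^(k) conj(psi_i).  f^(k) conj psi_i
   is F_{k+i+1}-measurable, so its integral is computed at that level. *)
Definition fourier (m : nat -> nat) (f : nat -> (nat -> nat) -> Cx) (i : nat) : Cx :=
  epsilon (inhabits C0)
    (fun c => Ccv (fun k => Cintegral_lvl m (k + S i)
                      (fun x => Cmul (f k x) (Cconj (psi m i x)))) c).

Definition partial_sum (m : nat -> nat) (f : nat -> (nat -> nat) -> Cx) (n : nat)
  (x : nat -> nat) : Cx := Csum n (fun k => Cmul (fourier m f k) (psi m k x)).

Definition fejer (m : nat -> nat) (f : nat -> (nat -> nat) -> Cx) (n : nat)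
  (x : nat -> nat) : Cx := Cscal (/ INR n) (Csum n (fun k => partial_sum m f k x)).

Definition norm_half_lvl (m : nat -> nat) (L : nat) (g : (nat -> nat) -> Cx) : R :=
  (integral_lvl m L (fun x => sqrt (Cnorm (g x)))) ^ 2.

(* Main.v *)
From Stdlib Require Import Reals Lra Lia List Arith ClassicalEpsilon FunctionalExtensionality.
From Coquelicot Require Complex.
Require Import Defs.
Import ListNotations.
Open Scope R_scope.

(** With [D_n] the Dirichlet and [K_n] the Fejer kernels, put
    [a_A = M_A (D_{M_(A+1)} - D_{M_A})], which up to a constant is an atom of [H_{1/2}].  For
    [N <= M_A] and [n = M_A + N] one finds [|sigma_n a_A| = (M_A / n) |N K_N| >= |N K_N| / 2].
    Take [N = M_1 + M_3 + ... + M_(2T-1)] with [T = A/2].  On the set [E_l] ([l = 2i < 2T]) of those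
    [x] with [x_0 = ... = x_(l-1) = 0], [x_l <> 0], [x_(l+1) <> 0], the part of [N] above [M_(l+1)]
    contributes nothing to [N K_N], the term [M_(l+1)] contributes at least [M_l^2], and the
    remainder, being below [M_l], at most [M_l^2 / 2].  Hence [|N K_N| >= M_l^2 / 2] on [E_l].
    The [E_l] are disjoint of measure at least [1 / (4 M_l)], so the integral of
    [|sigma_n a_A|^{1/2}] is at least of order [A], that is, of order [log n].  A gliding-hump sum
    [f = sum_A s_A^2 a_A] with [sum_A s_A] finite and very sparse support then works: in
    [sigma_n f] the later terms vanish and the earlier ones are bounded independently of [n]. *)

(** * Complex numbers and finite sums *)

Definition RC (a : R) : Cx := (a, 0).
Definition Copp (z : Cx) : Cx := (- fst z, - snd z).
Definition Csub (z w : Cx) : Cx := Cadd z (Copp w).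

Declare Scope Cx_scope.
Delimit Scope Cx_scope with Cx.
Bind Scope Cx_scope with Cx.
Infix "+" := Cadd : Cx_scope.
Infix "*" := Cmul : Cx_scope.
Infix "-" := Csub : Cx_scope.
Notation "- z" := (Copp z) : Cx_scope.

Lemma Cx_ring_theory : ring_theory C0 C1 Cadd Cmul Csub Copp eq.
Proof.
  constructor; intros; try reflexivity; unfold Cadd, Cmul, Copp, C0, C1;
    try (destruct x as [a b]); try (destruct y as [c d]); try (destruct z as [u v]);
    simpl; f_equal; ring.
Qed.
Add Ring Cx_ring : Cx_ring_theory.

Lemma Cx_eq (z w : Cx) : fst z = fst w -> snd z = snd w -> z = w.
Proof. destruct z, w; simpl; intros; subst; reflexivity. Qed.

Lemma Cscal_RC a z : Cscal a z = (RC a * z)%Cx.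
Proof. apply Cx_eq; unfold Cscal, RC, Cmul; simpl; ring. Qed.

Lemma RC_plus a b : RC (a + b) = (RC a + RC b)%Cx.
Proof. apply Cx_eq; unfold RC, Cadd; simpl; ring. Qed.

Lemma RC_mult a b : RC (a * b) = (RC a * RC b)%Cx.
Proof. apply Cx_eq; unfold RC, Cmul; simpl; ring. Qed.

Lemma Cnorm_ge0 z : 0 <= Cnorm z.
Proof. apply sqrt_pos. Qed.

(** [Cx] and [Cnorm] are convertible to Coquelicot's [C] and [Cmod], so the facts about the modulus
    transfer as they stand. *)
Lemma Cnorm_mul z w : Cnorm (z * w) = Cnorm z * Cnorm w.
Proof. exact (Complex.Cmod_mult z w). Qed.

Lemma Cnorm_add z w : Cnorm (z + w) <= Cnorm z + Cnorm w.
Proof. exact (Complex.Cmod_triangle z w). Qed.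

Lemma Cnorm_opp z : Cnorm (- z) = Cnorm z.
Proof. exact (Complex.Cmod_opp z). Qed.

Lemma Cnorm_RC a : Cnorm (RC a) = Rabs a.
Proof. exact (Complex.Cmod_R a). Qed.

Lemma Cnorm_C0 : Cnorm C0 = 0.
Proof. exact Complex.Cmod_0. Qed.

Lemma Cnorm_C1 : Cnorm C1 = 1.
Proof. exact Complex.Cmod_1. Qed.

Lemma Cnorm_eq0 z : Cnorm z = 0 -> z = C0.
Proof. exact (Complex.Cmod_eq_0 z). Qed.

Lemma Cmul_eq0 z w : (z * w)%Cx = C0 -> z <> C0 -> w = C0.
Proof.
  intros H Hz; apply Cnorm_eq0.
  assert (H1 : Cnorm z * Cnorm w = 0) by (rewrite <- Cnorm_mul, H; apply Cnorm_C0).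
  destruct (Rmult_integral _ _ H1) as [H2 | H2]; [ | exact H2].
  exfalso; exact (Hz (Cnorm_eq0 _ H2)).
Qed.

Lemma Csub_neq0 z w : z <> w -> (z - w)%Cx <> C0.
Proof. intros H E; apply H; replace z with ((z - w) + w)%Cx by ring; rewrite E; ring. Qed.

Lemma Cnorm_expi t : Cnorm (Cexpi t) = 1.
Proof.
  unfold Cnorm, Cexpi; simpl fst; simpl snd.
  replace (cos t ^ 2 + sin t ^ 2) with 1; [apply sqrt_1 | ].
  rewrite <- (sin2_cos2 t); unfold Rsqr; ring.
Qed.

Lemma Cexpi_add s t : Cexpi (s + t) = (Cexpi s * Cexpi t)%Cx.
Proof. apply Cx_eq; unfold Cexpi, Cmul; simpl; [rewrite cos_plus | rewrite sin_plus]; ring. Qed.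

Lemma Cexpi_0 : Cexpi 0 = C1.
Proof. unfold Cexpi, C1; rewrite cos_0, sin_0; reflexivity. Qed.

Lemma Cpow_expi t n : Cpow (Cexpi t) n = Cexpi (INR n * t).
Proof.
  induction n as [ | n IH].
  - simpl; rewrite Rmult_0_l, Cexpi_0; reflexivity.
  - rewrite S_INR; simpl Cpow; rewrite IH, <- Cexpi_add; f_equal; ring.
Qed.

Lemma Cexpi_2PI_mult n : Cexpi (INR n * (2 * PI)) = C1.
Proof.
  rewrite <- Cpow_expi; unfold Cexpi; rewrite cos_2PI, sin_2PI; fold C1.
  induction n as [ | n IH]; simpl; [reflexivity | rewrite IH; ring].
Qed.

Lemma Cexpi_neq1 t : 0 < t < 2 * PI -> Cexpi t <> C1.
Proof.
  intros Ht E; injection E as E _.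
  assert (Hs : 0 < sin (t / 2)) by (apply sin_gt_0; lra).
  replace t with (2 * (t / 2)) in E by field.
  rewrite cos_2a_sin in E; nra.
Qed.

Lemma Cexpi_opp t : Cexpi (- t) = Cconj (Cexpi t).
Proof. unfold Cexpi, Cconj; simpl; rewrite cos_neg, sin_neg; reflexivity. Qed.

Lemma Cconj_mul z w : Cconj (z * w) = (Cconj z * Cconj w)%Cx.
Proof. apply Cx_eq; unfold Cconj, Cmul; simpl; ring. Qed.

Lemma Cconj_C1 : Cconj C1 = C1.
Proof. apply Cx_eq; unfold Cconj, C1; simpl; ring. Qed.

Lemma Cpow_C1 n : Cpow C1 n = C1.
Proof. induction n as [ | n IH]; simpl; [reflexivity | rewrite IH; ring]. Qed.

Lemma Csum_S n F : Csum (S n) F = (Csum n F + F n)%Cx.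
Proof.
  unfold Csum; rewrite seq_S, map_app, fold_right_app; simpl.
  generalize (map F (seq 0 n)); intros l.
  induction l as [ | z l IH]; simpl; [ring | rewrite IH; ring].
Qed.

Lemma Cprod_S n F : Cprod (S n) F = (Cprod n F * F n)%Cx.
Proof.
  unfold Cprod; rewrite seq_S, map_app, fold_right_app; simpl.
  generalize (map F (seq 0 n)); intros l.
  induction l as [ | z l IH]; simpl; [ring | rewrite IH; ring].
Qed.

Lemma Csum_ext n F G : (forall k, (k < n)%nat -> F k = G k) -> Csum n F = Csum n G.
Proof.
  induction n as [ | n IH]; intros H; [reflexivity | ].
  rewrite !Csum_S, H, IH by auto; reflexivity.
Qed.

Lemma Cprod_ext n F G : (forall k, (k < n)%nat -> F k = G k) -> Cprod n F = Cprod n G.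
Proof.
  induction n as [ | n IH]; intros H; [reflexivity | ].
  rewrite !Cprod_S, H, IH by auto; reflexivity.
Qed.

Lemma Csum_add n F G : Csum n (fun k => (F k + G k)%Cx) = (Csum n F + Csum n G)%Cx.
Proof.
  induction n as [ | n IH]; [unfold Csum; simpl; ring | ].
  rewrite !Csum_S, IH; ring.
Qed.

Lemma Csum_mul_l n z F : Csum n (fun k => (z * F k)%Cx) = (z * Csum n F)%Cx.
Proof.
  induction n as [ | n IH]; [unfold Csum; simpl; ring | ].
  rewrite !Csum_S, IH; ring.
Qed.

Lemma Csum_zero n F : (forall k, (k < n)%nat -> F k = C0) -> Csum n F = C0.
Proof.
  induction n as [ | n IH]; intros H; [reflexivity | ].
  rewrite Csum_S, H, IH by auto; ring.
Qed.

Lemma Csum_const n z : Csum n (fun _ => z) = (RC (INR n) * z)%Cx.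
Proof.
  induction n as [ | n IH]; [apply Cx_eq; unfold Csum, RC, Cmul; simpl; ring | ].
  rewrite Csum_S, IH, S_INR, RC_plus; change (RC 1) with C1; ring.
Qed.

Lemma Csum_split a b F : Csum (a + b) F = (Csum a F + Csum b (fun k => F (a + k)%nat))%Cx.
Proof.
  induction b as [ | b IH].
  - rewrite Nat.add_0_r; unfold Csum at 3; simpl; ring.
  - rewrite Nat.add_succ_r, !Csum_S, IH; ring.
Qed.

Lemma Csum_delta n i F :
  (i < n)%nat -> (forall k, (k < n)%nat -> k <> i -> F k = C0) -> Csum n F = F i.
Proof.
  induction n as [ | n IH]; intros Hi H; [lia | ].
  rewrite Csum_S; destruct (Nat.eq_dec i n) as [-> | Hne].
  - rewrite Csum_zero; [ring | intros; apply H; lia].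
  - rewrite IH, (H n); [ring | lia | lia | lia | intros; apply H; lia].
Qed.

Lemma Cprod_mul n F G : Cprod n (fun k => (F k * G k)%Cx) = (Cprod n F * Cprod n G)%Cx.
Proof.
  induction n as [ | n IH]; [unfold Cprod; simpl; ring | ].
  rewrite !Cprod_S, IH; ring.
Qed.

Lemma Cprod_zero n F k : (k < n)%nat -> F k = C0 -> Cprod n F = C0.
Proof.
  induction n as [ | n IH]; intros Hk H; [lia | ].
  rewrite Cprod_S; destruct (Nat.eq_dec k n) as [-> | Hne].
  - rewrite H; ring.
  - rewrite IH; [ring | lia | exact H].
Qed.

Lemma Cprod_one n F : (forall k, (k < n)%nat -> F k = C1) -> Cprod n F = C1.
Proof.
  induction n as [ | n IH]; intros H; [reflexivity | ].
  rewrite Cprod_S, H, IH by auto; ring.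
Qed.

Lemma Cprod_conj n F : Cconj (Cprod n F) = Cprod n (fun k => Cconj (F k)).
Proof.
  induction n as [ | n IH]; [apply Cconj_C1 | ].
  rewrite !Cprod_S, Cconj_mul, IH; reflexivity.
Qed.

Lemma geom_sum w n : ((w - C1) * Csum n (Cpow w) = Cpow w n - C1)%Cx.
Proof.
  induction n as [ | n IH]; [unfold Csum; simpl; ring | ].
  rewrite Csum_S; replace ((w - C1) * (Csum n (Cpow w) + Cpow w n))%Cx
    with ((w - C1) * Csum n (Cpow w) + (w - C1) * Cpow w n)%Cx by ring.
  rewrite IH; simpl; ring.
Qed.

Lemma geom_sum_root_of_unity w n : Cpow w n = C1 -> w <> C1 -> Csum n (Cpow w) = C0.
Proof.
  intros Hw H1; apply (Cmul_eq0 (w - C1)); [ | apply Csub_neq0, H1].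
  rewrite geom_sum, Hw; ring.
Qed.

(** * Finite real sums and products; subadditivity of the square root *)

Fixpoint Rsum (n : nat) (F : nat -> R) : R :=
  match n with O => 0 | S n => Rsum n F + F n end.
Fixpoint Rprod (n : nat) (F : nat -> R) : R :=
  match n with O => 1 | S n => Rprod n F * F n end.

Lemma Rsum_le n F G : (forall k, (k < n)%nat -> F k <= G k) -> Rsum n F <= Rsum n G.
Proof.
  induction n as [ | n IH]; intros H; simpl; [lra | ].
  apply Rplus_le_compat; [apply IH; intros; apply H; lia | apply H; lia].
Qed.

Lemma Rsum_mul_l n a F : Rsum n (fun k => a * F k) = a * Rsum n F.
Proof. induction n as [ | n IH]; simpl; [ring | rewrite IH; ring]. Qed.

Lemma Rsum_const n a : Rsum n (fun _ => a) = INR n * a.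
Proof. induction n as [ | n IH]; [simpl; ring | rewrite S_INR; simpl; rewrite IH; ring]. Qed.

Lemma Rsum_ge0 n F : (forall k, (k < n)%nat -> 0 <= F k) -> 0 <= Rsum n F.
Proof.
  intros H; replace 0 with (Rsum n (fun _ => 0)); [apply Rsum_le, H | ].
  rewrite Rsum_const; ring.
Qed.

Lemma Rsum_mono n p F : (n <= p)%nat -> (forall k, 0 <= F k) -> Rsum n F <= Rsum p F.
Proof. intros Hnp HF; induction Hnp as [ | p _ IH]; simpl; [lra | specialize (HF p); lra]. Qed.

(** At most one term is nonzero, so the sum is one of its terms or 0. This turns a bound on each of
    several disjoint sets into a bound on the sum of the corresponding functions. *)
Lemma Rsum_disjoint_le n F b :
  0 <= b -> (forall i, (i < n)%nat -> F i <= b) ->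
  (forall i j, (i < j < n)%nat -> F i = 0 \/ F j = 0) -> Rsum n F <= b.
Proof.
  intros Hb; induction n as [ | n IH]; intros Hle Hdis; simpl; [exact Hb | ].
  destruct (Req_dec (F n) 0) as [E | E].
  - rewrite E, Rplus_0_r; apply IH; intros; [apply Hle | apply Hdis]; lia.
  - assert (Rsum n F <= Rsum n (fun _ => 0)) as H.
    { apply Rsum_le; intros k Hk; destruct (Hdis k n ltac:(lia)) as [-> | ?]; [lra | contradiction]. }
    rewrite Rsum_const in H; specialize (Hle n (Nat.lt_succ_diag_r n)); lra.
Qed.

Lemma sqrt_plus_le a b : 0 <= a -> 0 <= b -> sqrt (a + b) <= sqrt a + sqrt b.
Proof.
  intros Ha Hb; pose proof (sqrt_pos a); pose proof (sqrt_pos b).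
  rewrite <- (sqrt_Rsqr (sqrt a + sqrt b)) by lra.
  apply sqrt_le_1_alt; unfold Rsqr.
  pose proof (sqrt_sqrt a Ha); pose proof (sqrt_sqrt b Hb); nra.
Qed.

(** Stands in for the triangle inequality, which fails in [L_{1/2}]: the integral of the square root
    of a sum is estimated term by term. *)
Lemma sqrt_Rsum_le n F :
  (forall k, 0 <= F k) -> sqrt (Rsum n F) <= Rsum n (fun k => sqrt (F k)).
Proof.
  intros HF; induction n as [ | n IH]; simpl; [rewrite sqrt_0; lra | ].
  eapply Rle_trans; [apply sqrt_plus_le; auto; apply Rsum_ge0; auto | lra].
Qed.

Lemma Cnorm_Csum_le n F : Cnorm (Csum n F) <= Rsum n (fun k => Cnorm (F k)).
Proof.
  induction n as [ | n IH]; [unfold Csum; simpl; rewrite Cnorm_C0; lra | ].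
  rewrite Csum_S; simpl; eapply Rle_trans; [apply Cnorm_add | lra].
Qed.

(** * Vilenkin functions and kernels *)

Lemma Mk_pos m (hm : forall k, (2 <= m k)%nat) k : (1 <= Mk m k)%nat.
Proof. induction k as [ | k IH]; simpl; [lia | specialize (hm k); nia]. Qed.

Lemma Mk_double m (hm : forall k, (2 <= m k)%nat) k : (2 * Mk m k <= Mk m (S k))%nat.
Proof. simpl; specialize (hm k); nia. Qed.

Lemma Mk_gt m (hm : forall k, (2 <= m k)%nat) k : (k < Mk m k)%nat.
Proof.
  induction k as [ | k IH]; [simpl; lia | ].
  pose proof (Mk_double m hm k); lia.
Qed.

Lemma Mk_mono m (hm : forall k, (2 <= m k)%nat) k l : (k <= l)%nat -> (Mk m k <= Mk m l)%nat.
Proof.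
  intros H; induction H as [ | l _ IH]; [lia | pose proof (Mk_double m hm l); lia].
Qed.

Lemma Mk_divide m k l : (k <= l)%nat -> exists q, Mk m l = (q * Mk m k)%nat.
Proof.
  intros H; induction H as [ | l _ [q IH]]; [exists 1%nat; lia | ].
  exists (m l * q)%nat; simpl; rewrite IH; lia.
Qed.

Lemma digit_high m n j : (n < Mk m j)%nat -> digit m n j = 0%nat.
Proof.
  intros H; unfold digit; rewrite Nat.div_small by exact H.
  apply Nat.Div0.mod_0_l.
Qed.

Lemma digit_low m (hm : forall k, (2 <= m k)%nat) q c K j :
  (j < K)%nat -> digit m (q * Mk m K + c) j = digit m c j.
Proof.
  intros Hj; unfold digit.
  destruct (Mk_divide m (S j) K Hj) as [p Hp]; rewrite Hp; simpl Mk.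
  pose proof (Mk_pos m hm j); pose proof (hm j).
  replace (q * (p * (m j * Mk m j)) + c)%nat with (c + (q * p * m j) * Mk m j)%nat by ring.
  rewrite Nat.div_add by lia; apply Nat.Div0.mod_add.
Qed.

Lemma digit_shift m (hm : forall k, (2 <= m k)%nat) q c K j :
  (K <= j)%nat -> (c < Mk m K)%nat -> digit m (q * Mk m K + c) j = digit m (q * Mk m K) j.
Proof.
  intros Hj Hc; unfold digit; f_equal.
  destruct (Mk_divide m K j Hj) as [p Hp]; rewrite Hp.
  pose proof (Mk_pos m hm j); assert (p <> 0)%nat by (intros ->; lia).
  rewrite (Nat.mul_comm p), <- !Nat.Div0.div_div.
  rewrite Nat.div_add_l, Nat.div_mul, (Nat.div_small c) by lia.
  now rewrite Nat.add_0_r.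
Qed.

(** Induction on [k] shows that [i] and [j] agree modulo [M_k], since digit [k] is what leads from
    the residue modulo [M_k] to the one modulo [M_{k+1}]. At [k = K] the residues are the numbers
    themselves. *)
Lemma digit_inj m (hm : forall k, (2 <= m k)%nat) K i j :
  (i < Mk m K)%nat -> (j < Mk m K)%nat ->
  (forall k, (k < K)%nat -> digit m i k = digit m j k) -> i = j.
Proof.
  intros Hi Hj H.
  assert (E : forall k, (k <= K)%nat -> (i mod Mk m k = j mod Mk m k)%nat).
  { induction k as [ | k IH]; intros Hk; [reflexivity | ].
    simpl Mk; rewrite (Nat.mul_comm (m k)), !Nat.Div0.mod_mul_r.
    fold (digit m i k) (digit m j k); rewrite IH, H by lia; reflexivity. }
  specialize (E K (le_n K)); rewrite !Nat.mod_small in E; assumption.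
Qed.

(** Digits at positions [k] with [n < M_k] vanish and give factors 1. Functions with different
    indices can thus be compared over a common range of coordinates. *)
Lemma psi_prod m (hm : forall k, (2 <= m k)%nat) n K x :
  (n < Mk m K)%nat -> psi m n x = Cprod K (fun k => Cpow (rad m k x) (digit m n k)).
Proof.
  intros Hn; unfold psi.
  assert (H : forall K L, (n < Mk m K)%nat -> (K <= L)%nat ->
     Cprod L (fun k => Cpow (rad m k x) (digit m n k))
     = Cprod K (fun k => Cpow (rad m k x) (digit m n k))).
  { intros K' L HK HKL; induction HKL as [ | L HKL IH]; [reflexivity | ].
    rewrite Cprod_S, IH, digit_high; [simpl; ring | ].
    pose proof (Mk_mono m hm _ _ HKL); lia. }
  destruct (Nat.le_ge_cases (S n) K) as [L | L]; [symmetry | ]; apply H; auto.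
  pose proof (Mk_gt m hm (S n)); lia.
Qed.

(** The addition causes no carry: digits below [K] come from [c], those from [K] on from [q * M_K].
    This multiplicativity drives all the kernel recursions. *)
Lemma psi_add m (hm : forall k, (2 <= m k)%nat) q c K x :
  (c < Mk m K)%nat -> psi m (q * Mk m K + c) x = (psi m (q * Mk m K) x * psi m c x)%Cx.
Proof.
  intros Hc; set (L := S (q * Mk m K + c)).
  pose proof (Mk_gt m hm L).
  rewrite !(psi_prod m hm) with (K := L) by lia; rewrite <- Cprod_mul; apply Cprod_ext.
  intros k Hk; destruct (Nat.lt_ge_cases k K) as [H1 | H1].
  - rewrite digit_low by assumption.
    replace (q * Mk m K)%nat with (q * Mk m K + 0)%nat by lia.
    rewrite digit_low, (digit_high m 0) by (auto; apply Mk_pos; auto); simpl; ring.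
  - rewrite digit_shift, (digit_high m c) by (auto; pose proof (Mk_mono m hm _ _ H1); lia).
    simpl; ring.
Qed.

Lemma psi_mul_Mk m (hm : forall k, (2 <= m k)%nat) b K x :
  (b < m K)%nat -> psi m (b * Mk m K) x = Cpow (rad m K x) b.
Proof.
  intros Hb; pose proof (Mk_pos m hm K).
  rewrite (psi_prod m hm) with (K := S K) by (simpl; nia).
  rewrite Cprod_S, Cprod_one.
  - unfold digit; rewrite Nat.div_mul, Nat.mod_small by lia; ring.
  - intros k Hk; replace (b * Mk m K)%nat with (b * Mk m K + 0)%nat by lia.
    rewrite digit_low, digit_high by (auto; apply Mk_pos; auto); reflexivity.
Qed.

Lemma rad_zero m k x : x k = 0%nat -> rad m k x = C1.
Proof.
  intros E; unfold rad; rewrite E; simpl INR; unfold Rdiv.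
  rewrite Rmult_0_r, Rmult_0_l; apply Cexpi_0.
Qed.

Lemma psi_eq1 m (hm : forall k, (2 <= m k)%nat) l c x :
  (forall j, (j < l)%nat -> x j = 0%nat) -> (c < Mk m l)%nat -> psi m c x = C1.
Proof.
  intros Hx Hc; rewrite (psi_prod m hm) with (K := l) by exact Hc; apply Cprod_one.
  intros k Hk; rewrite rad_zero by auto; apply Cpow_C1.
Qed.

Lemma psi_local m (hm : forall k, (2 <= m k)%nat) l c x y :
  (forall j, (j < l)%nat -> x j = y j) -> (c < Mk m l)%nat -> psi m c x = psi m c y.
Proof.
  intros Hx Hc; rewrite !(psi_prod m hm) with (K := l) by exact Hc; apply Cprod_ext.
  intros k Hk; unfold rad; rewrite Hx by exact Hk; reflexivity.
Qed.

Lemma Cnorm_psi m n x : Cnorm (psi m n x) = 1.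
Proof.
  unfold psi; generalize (S n); intros K; induction K as [ | K IH]; [apply Cnorm_C1 | ].
  rewrite Cprod_S, Cnorm_mul, IH; unfold rad; rewrite Cpow_expi, Cnorm_expi; ring.
Qed.

Lemma Cnorm_rad m k x : Cnorm (rad m k x) = 1.
Proof. apply Cnorm_expi. Qed.

Lemma INR_m_pos (m : nat -> nat) (hm : forall k, (2 <= m k)%nat) k : 0 < INR (m k).
Proof. apply lt_0_INR; specialize (hm k); lia. Qed.

Lemma INR_Mk_pos m (hm : forall k, (2 <= m k)%nat) k : 0 < INR (Mk m k).
Proof. apply lt_0_INR; pose proof (Mk_pos m hm k); lia. Qed.

Lemma rad_pow_m m (hm : forall k, (2 <= m k)%nat) k x : Cpow (rad m k x) (m k) = C1.
Proof.
  unfold rad; rewrite Cpow_expi, <- (Cexpi_2PI_mult (x k)); f_equal.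
  field; pose proof (INR_m_pos m hm k); lra.
Qed.

Lemma rad_neq1 m (hm : forall k, (2 <= m k)%nat) k x :
  (x k < m k)%nat -> x k <> 0%nat -> rad m k x <> C1.
Proof.
  intros H1 H2; apply Cexpi_neq1; pose proof (INR_m_pos m hm k); pose proof PI_RGT_0.
  assert (0 < INR (x k)) by (apply lt_0_INR; lia).
  assert (INR (x k) < INR (m k)) by (apply lt_INR; lia).
  split; [apply Rdiv_lt_0_compat; nra | ].
  apply Rmult_lt_reg_r with (INR (m k)); [lra | ].
  unfold Rdiv; rewrite Rmult_assoc, Rinv_l by lra; nra.
Qed.

Lemma Csum_rad_pow m (hm : forall k, (2 <= m k)%nat) k x :
  (x k < m k)%nat ->
  Csum (m k) (Cpow (rad m k x)) = if Nat.eqb (x k) 0 then RC (INR (m k)) else C0.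
Proof.
  intros Hx; destruct (Nat.eqb_spec (x k) 0) as [E | E].
  - rewrite rad_zero by exact E.
    rewrite (Csum_ext _ _ (fun _ => C1)) by (intros; apply Cpow_C1).
    rewrite Csum_const; ring.
  - apply geom_sum_root_of_unity; [apply rad_pow_m | apply rad_neq1]; auto.
Qed.

(* For [e = psi_. (x)] these are the Dirichlet kernel [D_n (x)] and [n K_n (x)], [K_n] the
   Fejer kernel. *)
Definition dker (e : nat -> Cx) (n : nat) : Cx := Csum n e.
Definition fker (e : nat -> Cx) (n : nat) : Cx := Csum n (dker e).

Lemma dker_add e a c :
  (forall k, (k < c)%nat -> e (a + k)%nat = (e a * e k)%Cx) ->
  dker e (a + c) = (dker e a + e a * dker e c)%Cx.
Proof.
  intros H; unfold dker; rewrite Csum_split, <- Csum_mul_l; f_equal; apply Csum_ext, H.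
Qed.

Lemma fker_add e a c :
  (forall k, (k < c)%nat -> e (a + k)%nat = (e a * e k)%Cx) ->
  fker e (a + c) = (fker e a + RC (INR c) * dker e a + e a * fker e c)%Cx.
Proof.
  intros H; unfold fker; rewrite Csum_split, <- Csum_mul_l, <- Csum_const.
  rewrite (Csum_ext c _ (fun k => (dker e a + e a * dker e k)%Cx)).
  - rewrite Csum_add; ring.
  - intros k Hk; apply dker_add; intros j Hj; apply H; lia.
Qed.

Lemma Cnorm_dker_psi_le m x n : Cnorm (dker (fun k => psi m k x) n) <= INR n.
Proof.
  unfold dker; eapply Rle_trans; [apply Cnorm_Csum_le | ].
  rewrite <- (Rmult_1_r (INR n)), <- Rsum_const; apply Rsum_le.
  intros; rewrite Cnorm_psi; lra.
Qed.

(** Sum the bounds [|D_k| <= k] over [k < n]. The factor 1/2 matters: it makes the remainder in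
    [fker_psi_lower_bound] at most half of the main term. *)
Lemma Cnorm_fker_psi_le m x n : Cnorm (fker (fun k => psi m k x) n) <= INR n ^ 2 / 2.
Proof.
  unfold fker; induction n as [ | n IH]; [unfold Csum; simpl; rewrite Cnorm_C0; lra | ].
  rewrite Csum_S, S_INR; eapply Rle_trans; [apply Cnorm_add | ].
  pose proof (Cnorm_dker_psi_le m x n); lra.
Qed.

Lemma dker_psi_mul m (hm : forall k, (2 <= m k)%nat) K x b : (b <= m K)%nat ->
  dker (fun k => psi m k x) (b * Mk m K)
  = (Csum b (Cpow (rad m K x)) * dker (fun k => psi m k x) (Mk m K))%Cx.
Proof.
  induction b as [ | b IH]; intros Hb; [unfold dker, Csum; simpl; ring | ].
  replace (S b * Mk m K)%nat with (b * Mk m K + Mk m K)%nat by lia.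
  rewrite dker_add by (intros; apply psi_add; auto).
  rewrite IH, Csum_S, psi_mul_Mk by (auto; lia); ring.
Qed.

Lemma dker_psi_Mk m (hm : forall k, (2 <= m k)%nat) K x :
  (forall j, (j < K)%nat -> x j = 0%nat) ->
  dker (fun k => psi m k x) (Mk m K) = RC (INR (Mk m K)).
Proof.
  intros Hx; unfold dker; rewrite (Csum_ext _ _ (fun _ => C1)).
  - rewrite Csum_const; ring.
  - intros; eapply psi_eq1; eauto.
Qed.

(** [D_{M_{j+1}}] has as a factor the sum of all powers of [r_j(x)], a nontrivial root of unity, and
    each later [D_{M_K}] is a multiple of it. *)
Lemma dker_psi_Mk_eq0 m (hm : forall k, (2 <= m k)%nat) K x j :
  inG m x -> (j < K)%nat -> x j <> 0%nat -> dker (fun k => psi m k x) (Mk m K) = C0.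
Proof.
  intros Hx Hj Hxj; induction Hj as [ | K Hj IH]; simpl Mk; rewrite dker_psi_mul by auto.
  - rewrite Csum_rad_pow by auto; destruct (Nat.eqb_spec (x j) 0); [lia | ring].
  - rewrite IH; ring.
Qed.

(* Multiplying by [r - 1] lets the geometric sums telescope. *)
Lemma fker_psi_mul m (hm : forall k, (2 <= m k)%nat) K x b : (b <= m K)%nat ->
  let e := fun k => psi m k x in
  ((rad m K x - C1) * fker e (b * Mk m K)
   = RC (INR (Mk m K)) * (dker e (b * Mk m K) - RC (INR b) * dker e (Mk m K))
     + (Cpow (rad m K x) b - C1) * fker e (Mk m K))%Cx.
Proof.
  intros Hb e; set (r := rad m K x).
  induction b as [ | b IH].
  { unfold fker, dker, Csum; simpl; apply Cx_eq; unfold RC, Csub, Copp, Cadd, Cmul, C0, C1;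
      simpl; ring. }
  replace (S b * Mk m K)%nat with (b * Mk m K + Mk m K)%nat by lia.
  assert (He : forall k, (k < Mk m K)%nat ->
             e (b * Mk m K + k)%nat = (e (b * Mk m K)%nat * e k)%Cx)
    by (intros; apply psi_add; auto).
  assert (Er : e (b * Mk m K)%nat = Cpow r b) by (apply psi_mul_Mk; auto).
  rewrite fker_add, dker_add by exact He; rewrite Er.
  replace ((r - C1) * (fker e (b * Mk m K) + RC (INR (Mk m K)) * dker e (b * Mk m K)
             + Cpow r b * fker e (Mk m K)))%Cx
    with ((r - C1) * fker e (b * Mk m K)
          + RC (INR (Mk m K)) * ((r - C1) * dker e (b * Mk m K))
          + (r - C1) * (Cpow r b * fker e (Mk m K)))%Cx by ring.
  rewrite IH by lia.
  replace ((r - C1) * dker e (b * Mk m K))%Cx with ((Cpow r b - C1) * dker e (Mk m K))%Cx.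
  - rewrite S_INR, RC_plus; change (RC 1) with C1; simpl Cpow; ring.
  - unfold e at 2; rewrite dker_psi_mul by (auto; lia); fold e; fold r.
    rewrite <- geom_sum; ring.
Qed.

Lemma fker_psi_lower_bound m (hm : forall k, (2 <= m k)%nat) l q c x :
  inG m x -> (forall j, (j < l)%nat -> x j = 0%nat) -> x l <> 0%nat -> x (S l) <> 0%nat ->
  (c < Mk m l)%nat ->
  INR (Mk m l) ^ 2 / 2
  <= Cnorm (fker (fun k => psi m k x) (q * Mk m (S (S l)) + (Mk m (S l) + c))).
Proof.
  intros Hx H0 Hl Hl1 Hc; set (e := fun k => psi m k x).
  assert (D1 : dker e (Mk m (S l)) = C0) by (apply dker_psi_Mk_eq0 with l; auto).
  assert (D2 : dker e (Mk m (S (S l))) = C0) by (apply dker_psi_Mk_eq0 with l; auto).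
  (* In [fker_psi_mul] with [b = m_{l+1}] both Dirichlet kernels vanish and [r^b = 1], so [(r - 1)]
     times the kernel is 0, while [r <> 1] because [x_{l+1} <> 0]. *)
  assert (F2 : fker e (Mk m (S (S l))) = C0).
  { apply (Cmul_eq0 (rad m (S l) x - C1)); [ | apply Csub_neq0, rad_neq1; auto].
    change (Mk m (S (S l))) with (m (S l) * Mk m (S l))%nat.
    unfold e; rewrite fker_psi_mul by auto; fold e.
    change (m (S l) * Mk m (S l))%nat with (Mk m (S (S l))).
    rewrite D1, D2, rad_pow_m by auto; ring. }
  assert (F3 : forall p, dker e (p * Mk m (S (S l))) = C0 /\ fker e (p * Mk m (S (S l))) = C0).
  { induction p as [ | p [IHd IHf]]; [split; reflexivity | ].
    replace (S p * Mk m (S (S l)))%nat with (p * Mk m (S (S l)) + Mk m (S (S l)))%nat by lia.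
    rewrite dker_add, fker_add by (intros; apply psi_add; auto).
    rewrite IHd, IHf, D2, F2; split; ring. }
  pose proof (Mk_double m hm l); pose proof (Mk_double m hm (S l)).
  rewrite fker_add by (intros; apply psi_add; auto; lia).
  destruct (F3 q) as [-> ->].
  replace (C0 + RC (INR (Mk m (S l) + c)) * C0
           + e (q * Mk m (S (S l)))%nat * fker e (Mk m (S l) + c))%Cx
    with (e (q * Mk m (S (S l)))%nat * fker e (Mk m (S l) + c))%Cx by ring.
  rewrite Cnorm_mul; unfold e at 1; rewrite Cnorm_psi, Rmult_1_l.
  rewrite fker_add.
  2:{ intros k Hk; pose proof (psi_add m hm 1 k (S l) x) as E.
      rewrite !Nat.mul_1_l in E; apply E; lia. }
  rewrite D1.
  set (M := INR (Mk m l)).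
  assert (HM : 0 < M) by (apply INR_Mk_pos; auto).
  (* Here [(r_l - 1)] times the kernel is exactly [- m_l M_l^2]; divide by
     [|r_l - 1| <= 2 <= m_l]. *)
  assert (F1 : M ^ 2 <= Cnorm (fker e (Mk m (S l)))).
  { assert (E : ((rad m l x - C1) * fker e (Mk m (S l)))%Cx
                = RC (- (INR (m l) * M ^ 2))).
    { change (Mk m (S l)) with (m l * Mk m l)%nat.
      unfold e; rewrite fker_psi_mul by auto; fold e.
      change (m l * Mk m l)%nat with (Mk m (S l)).
      rewrite D1, rad_pow_m by auto; unfold e; rewrite dker_psi_Mk by auto; fold M.
      apply Cx_eq; unfold RC, Csub, Copp, Cadd, Cmul, C0, C1; simpl; ring. }
    apply (f_equal Cnorm) in E; rewrite Cnorm_mul, Cnorm_RC, Rabs_Ropp in E.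
    assert (Hm2 : 2 <= INR (m l)) by (apply (le_INR 2), hm).
    rewrite Rabs_pos_eq in E by nra.
    assert (Cnorm (rad m l x - C1) <= 2).
    { unfold Csub; eapply Rle_trans; [apply Cnorm_add | ].
      rewrite Cnorm_rad, Cnorm_opp, Cnorm_C1; lra. }
    pose proof (Cnorm_ge0 (fker e (Mk m (S l)))); nra. }
  assert (Fc : Cnorm (fker e c) <= M ^ 2 / 2).
  { eapply Rle_trans; [apply Cnorm_fker_psi_le | ].
    assert (INR c <= M) by (apply le_INR; lia); pose proof (pos_INR c); nra. }
  set (u := fker e (Mk m (S l))) in *; set (v := fker e c) in *.
  set (p := e (Mk m (S l))).
  assert (Hp : Cnorm (p * v) = Cnorm v) by (rewrite Cnorm_mul; unfold p, e; rewrite Cnorm_psi; ring).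
  (* Reverse triangle inequality: the main term [u] is recovered from the whole sum by subtracting
     [p * v]. *)
  pose proof (Cnorm_add (u + RC (INR c) * C0 + p * v) (- (p * v))) as T.
  rewrite Cnorm_opp, Hp in T.
  replace (u + RC (INR c) * C0 + p * v + - (p * v))%Cx with u in T by ring.
  lra.
Qed.

(** * Integration on the group *)

(** Padding by 0 in [ext] stays inside every [Z_{m_k}], so each tuple represents a point of the
    group. *)
Lemma tuples_spec m (hm : forall k, (2 <= m k)%nat) L t :
  In t (tuples m L) -> length t = L /\ inG m (ext t).
Proof.
  revert t; induction L as [ | L IH]; simpl; intros t Ht.
  - destruct Ht as [<- | []]; split; [reflexivity | ].
    intros k; specialize (hm k); unfold ext; destruct k; simpl; lia.
  - apply in_flat_map in Ht as [s [Hs Ht]]; apply in_map_iff in Ht as [a [<- Ha]].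
    apply in_seq in Ha; destruct (IH s Hs) as [Hl Hg]; split.
    + rewrite length_app; simpl; lia.
    + intros k; unfold ext; destruct (Nat.lt_trichotomy k L) as [H | [-> | H]].
      * rewrite app_nth1 by lia; apply Hg.
      * rewrite app_nth2, Hl, Nat.sub_diag by lia; simpl; lia.
      * rewrite nth_overflow; [specialize (hm k); lia | rewrite length_app; simpl; lia].
Qed.

Lemma ext_snoc t a : ext (t ++ [a]) = upd (ext t) (length t) a.
Proof.
  apply functional_extensionality; intros k; unfold ext, upd.
  destruct (Nat.eqb_spec k (length t)) as [-> | H].
  - rewrite app_nth2, Nat.sub_diag by lia; reflexivity.
  - destruct (Nat.lt_ge_cases k (length t)); [apply app_nth1; lia | ].
    rewrite !nth_overflow; auto; rewrite length_app; simpl; lia.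
Qed.

Lemma integral_ext m (hm : forall k, (2 <= m k)%nat) L g h :
  (forall x, inG m x -> g x = h x) -> integral_lvl m L g = integral_lvl m L h.
Proof.
  intros H; unfold integral_lvl; f_equal; f_equal; apply map_ext_in.
  intros t Ht; apply H, (tuples_spec m hm L t Ht).
Qed.

Lemma integral_le m (hm : forall k, (2 <= m k)%nat) L g h :
  (forall x, inG m x -> g x <= h x) -> integral_lvl m L g <= integral_lvl m L h.
Proof.
  intros H; unfold integral_lvl; apply Rmult_le_compat_r.
  { left; apply Rinv_0_lt_compat, INR_Mk_pos, hm. }
  assert (H' : forall t, In t (tuples m L) -> g (ext t) <= h (ext t))
    by (intros t Ht; apply H, (tuples_spec m hm L t Ht)).
  induction (tuples m L) as [ | t l IH]; simpl; [lra | ].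
  apply Rplus_le_compat; [apply H'; left; reflexivity | apply IH; intros; apply H'; right; auto].
Qed.

Lemma integral_plus m L g h :
  integral_lvl m L (fun x => g x + h x) = integral_lvl m L g + integral_lvl m L h.
Proof.
  unfold integral_lvl; rewrite <- Rdiv_plus_distr; f_equal.
  induction (tuples m L) as [ | t l IH]; simpl; [ring | rewrite IH; ring].
Qed.

Lemma integral_mul_l m L a g :
  integral_lvl m L (fun x => a * g x) = a * integral_lvl m L g.
Proof.
  unfold integral_lvl, Rdiv; rewrite <- Rmult_assoc; f_equal.
  induction (tuples m L) as [ | t l IH]; simpl; [ring | rewrite IH; ring].
Qed.

Lemma integral_Rsum m L n (F : nat -> (nat -> nat) -> R) :
  integral_lvl m L (fun x => Rsum n (fun k => F k x))
  = Rsum n (fun k => integral_lvl m L (F k)).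
Proof.
  induction n as [ | n IH]; simpl.
  - pose proof (integral_mul_l m L 0 (fun _ => 0)) as E; rewrite !Rmult_0_l in E; exact E.
  - rewrite integral_plus, IH; reflexivity.
Qed.

(** Fubini in the last coordinate: each tuple of length [L] is followed in [tuples m (S L)] by a
    block of its [m L] extensions. *)
Lemma integral_S m (hm : forall k, (2 <= m k)%nat) L g :
  integral_lvl m (S L) g
  = integral_lvl m L (fun x => / INR (m L) * Rsum (m L) (fun a => g (upd x L a))).
Proof.
  rewrite integral_mul_l; unfold integral_lvl; simpl Mk; rewrite mult_INR.
  pose proof (INR_m_pos m hm L); pose proof (INR_Mk_pos m hm L).
  assert (E : fold_right Rplus 0 (map (fun t => g (ext t)) (tuples m (S L)))
    = fold_right Rplus 0
        (map (fun t => Rsum (m L) (fun a => g (upd (ext t) L a))) (tuples m L))).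
  { simpl tuples.
    assert (Hl : forall t, In t (tuples m L) -> length t = L)
      by (intros t Ht; apply (tuples_spec m hm L t Ht)).
    induction (tuples m L) as [ | t l IH]; [reflexivity | ].
    simpl; rewrite map_app, fold_right_app, IH by (intros; apply Hl; right; auto).
    assert (Ht : length t = L) by (apply Hl; left; reflexivity).
    generalize (fold_right Rplus 0
      (map (fun t0 => Rsum (m L) (fun a => g (upd (ext t0) L a))) l)).
    generalize (m L); intros n; induction n as [ | n IHn]; intros z; [simpl; ring | ].
    rewrite seq_S, !map_app, fold_right_app; simpl.
    rewrite IHn, ext_snoc, Ht; ring. }
  rewrite E; field; lra.
Qed.

(** Independence of the coordinates: averaging over the last one leaves the earlier factors
    untouched. *)
Lemma integral_prod m (hm : forall k, (2 <= m k)%nat) L (h : nat -> nat -> R) :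
  integral_lvl m L (fun x => Rprod L (fun k => h k (x k)))
  = Rprod L (fun k => / INR (m k) * Rsum (m k) (h k)).
Proof.
  induction L as [ | L IH]; [unfold integral_lvl; simpl; lra | ].
  rewrite integral_S by exact hm; simpl Rprod at 2; rewrite <- IH, Rmult_comm.
  rewrite <- integral_mul_l; apply integral_ext; auto; intros x _.
  rewrite Rmult_assoc, (Rmult_comm (Rsum _ (h L))), <- (Rsum_mul_l _ (Rprod _ _)); f_equal.
  assert (E : forall a n, (n <= L)%nat ->
    Rprod n (fun k => h k (upd x L a k)) = Rprod n (fun k => h k (x k))).
  { intros a n Hn; induction n as [ | n IHn]; [reflexivity | simpl].
    rewrite IHn by lia; unfold upd; destruct (Nat.eqb_spec n L); [lia | reflexivity]. }
  f_equal; apply functional_extensionality; intros a; simpl.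
  rewrite E by lia; unfold upd; rewrite Nat.eqb_refl; reflexivity.
Qed.

Lemma integral_const m (hm : forall k, (2 <= m k)%nat) L a :
  integral_lvl m L (fun _ => a) = a.
Proof.
  induction L as [ | L IH]; [unfold integral_lvl; simpl; lra | ].
  rewrite integral_S, <- IH at 1 by exact hm; apply integral_ext; auto.
  intros x _; rewrite Rsum_const; field; pose proof (INR_m_pos m hm L); lra.
Qed.

(** The indicator of a cylinder set constraining each coordinate separately, written as a product so
    that [integral_prod] computes its measure. *)
Definition box (P : nat -> nat -> bool) (L : nat) (x : nat -> nat) : R :=
  Rprod L (fun k => if P k (x k) then 1 else 0).

Lemma box_01 P L x :
  (box P L x = 1 /\ forall k, (k < L)%nat -> P k (x k) = true) \/ box P L x = 0.
Proof.
  unfold box; induction L as [ | L IH]; simpl; [left; split; [reflexivity | intros; lia] | ].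
  destruct IH as [[-> H] | ->]; [ | right; ring].
  destruct (P L (x L)) eqn:E; [left; split; [ring | ] | right; ring].
  intros k Hk; destruct (Nat.eq_dec k L) as [-> | Hne]; [exact E | apply H; lia].
Qed.

Lemma box_eq1 P L x : (forall k, (k < L)%nat -> P k (x k) = true) -> box P L x = 1.
Proof.
  unfold box; induction L as [ | L IH]; intros H; simpl; [reflexivity | ].
  rewrite IH, H by auto; ring.
Qed.

Lemma Rsum_true n (P : nat -> bool) :
  (forall a, P a = true) -> Rsum n (fun a => if P a then 1 else 0) = INR n.
Proof.
  intros H; replace (fun a => if P a then 1 else 0) with (fun _ : nat => 1).
  - rewrite Rsum_const; ring.
  - apply functional_extensionality; intros a; rewrite H; reflexivity.
Qed.

Lemma Rsum_eqb0 n : (1 <= n)%nat -> Rsum n (fun a => if Nat.eqb a 0 then 1 else 0) = 1.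
Proof.
  intros H; induction H as [ | n H IH]; simpl; [ring | ].
  rewrite IH; destruct n; [lia | simpl; ring].
Qed.

Lemma Rsum_neqb0 n :
  (1 <= n)%nat -> Rsum n (fun a => if negb (Nat.eqb a 0) then 1 else 0) = INR n - 1.
Proof.
  intros H; induction H as [ | n H IH]; [simpl; ring | ].
  rewrite S_INR; simpl; rewrite IH; destruct n; [lia | simpl; ring].
Qed.

(* Cosets [I_A(0)], and the sets on which [fker_psi_lower_bound] applies. *)
Definition cosetP (A k a : nat) : bool := (A <=? k)%nat || (a =? 0)%nat.
Definition shellP (l k a : nat) : bool :=
  if (k <? l)%nat then (a =? 0)%nat
  else if (k <=? S l)%nat then negb (a =? 0)%nat else true.

Lemma integral_coset m (hm : forall k, (2 <= m k)%nat) A L :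
  (A <= L)%nat -> integral_lvl m L (box (cosetP A) L) = / INR (Mk m A).
Proof.
  intros HAL; unfold box; rewrite integral_prod with (h := fun k a => if cosetP A k a then 1 else 0) by exact hm.
  induction HAL as [ | L HAL IH].
  - assert (H : forall n, (n <= A)%nat ->
      Rprod n (fun k => / INR (m k) * Rsum (m k) (fun a => if cosetP A k a then 1 else 0))
      = / INR (Mk m n)); [ | auto].
    induction n as [ | n IH]; intros Hn; [simpl; lra | ].
    change (Rprod n (fun k => / INR (m k) * Rsum (m k) (fun a => if cosetP A k a then 1 else 0))
            * (/ INR (m n) * Rsum (m n) (fun a => if cosetP A n a then 1 else 0))
            = / INR (m n * Mk m n)).
    rewrite IH, mult_INR by lia; unfold cosetP.
    rewrite (proj2 (Nat.leb_gt A n)) by lia; simpl orb.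
    rewrite Rsum_eqb0 by (specialize (hm n); lia).
    pose proof (INR_m_pos m hm n); pose proof (INR_Mk_pos m hm n); field; lra.
  - simpl; rewrite IH, Rsum_true.
    + pose proof (INR_m_pos m hm L); pose proof (INR_Mk_pos m hm A); field; lra.
    + intros a; unfold cosetP; rewrite (proj2 (Nat.leb_le A L)) by lia; reflexivity.
Qed.

(** The [l] coordinates forced to be 0 contribute [1 / M_l], the two nonzero ones
    [(m_k - 1) / m_k >= 1/2] each, and the free ones 1. *)
Lemma integral_shell m (hm : forall k, (2 <= m k)%nat) l L :
  (S (S l) <= L)%nat -> / 4 <= INR (Mk m l) * integral_lvl m L (box (shellP l) L).
Proof.
  intros HlL; unfold box; rewrite integral_prod with (h := fun k a => if shellP l k a then 1 else 0) by exact hm.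
  set (v := fun k => / INR (m k) * Rsum (m k) (fun a => if shellP l k a then 1 else 0)).
  assert (H : forall n, (n <= l)%nat -> Rprod n v = / INR (Mk m n)).
  { induction n as [ | n IH]; intros Hn; [simpl; lra | ].
    change (Rprod n v * v n = / INR (m n * Mk m n)).
    rewrite IH, mult_INR by lia; unfold v, shellP.
    rewrite (proj2 (Nat.ltb_lt n l)) by lia.
    rewrite Rsum_eqb0 by (specialize (hm n); lia).
    pose proof (INR_m_pos m hm n); pose proof (INR_Mk_pos m hm n); field; lra. }
  assert (Hv : forall k, (l <= k <= S l)%nat -> / 2 <= v k).
  { intros k Hk; unfold v, shellP; rewrite (proj2 (Nat.ltb_ge k l)), (proj2 (Nat.leb_le k (S l))) by lia.
    rewrite Rsum_neqb0 by (specialize (hm k); lia).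
    assert (2 <= INR (m k)) by (apply (le_INR 2), hm).
    apply Rmult_le_reg_l with (INR (m k)); [lra | ].
    rewrite <- Rmult_assoc, Rinv_r; lra. }
  assert (E : Rprod L v = Rprod (S (S l)) v).
  { induction HlL as [ | L HlL IH]; [reflexivity | ].
    change (Rprod L v * v L = Rprod (S (S l)) v); rewrite IH; unfold v at 2, shellP.
    rewrite (proj2 (Nat.ltb_ge L l)), (proj2 (Nat.leb_gt L (S l))) by lia.
    cbv iota; rewrite Rsum_const; pose proof (INR_m_pos m hm L); field; lra. }
  rewrite E; simpl; rewrite H by lia; pose proof (INR_Mk_pos m hm l).
  rewrite <- !Rmult_assoc, Rinv_r, Rmult_1_l by lra.
  pose proof (Hv l ltac:(lia)); pose proof (Hv (S l) ltac:(lia)); nra.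
Qed.

(** * Complex integrals, orthonormality and Fourier coefficients *)

Lemma fst_Csum n F : fst (Csum n F) = Rsum n (fun k => fst (F k)).
Proof. induction n as [ | n IH]; [reflexivity | rewrite Csum_S; simpl; rewrite IH; reflexivity]. Qed.

Lemma snd_Csum n F : snd (Csum n F) = Rsum n (fun k => snd (F k)).
Proof. induction n as [ | n IH]; [reflexivity | rewrite Csum_S; simpl; rewrite IH; reflexivity]. Qed.

Lemma Cintegral_ext m (hm : forall k, (2 <= m k)%nat) L g h :
  (forall x, inG m x -> g x = h x) -> Cintegral_lvl m L g = Cintegral_lvl m L h.
Proof.
  intros H; unfold Cintegral_lvl; f_equal; apply integral_ext; auto; intros; rewrite H; auto.
Qed.

Lemma Cintegral_Csum m L n (F : nat -> (nat -> nat) -> Cx) :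
  Cintegral_lvl m L (fun x => Csum n (fun k => F k x))
  = Csum n (fun k => Cintegral_lvl m L (F k)).
Proof.
  apply Cx_eq; unfold Cintegral_lvl; simpl.
  - rewrite fst_Csum; simpl; rewrite <- integral_Rsum; f_equal.
    apply functional_extensionality; intros; apply fst_Csum.
  - rewrite snd_Csum; simpl; rewrite <- integral_Rsum; f_equal.
    apply functional_extensionality; intros; apply snd_Csum.
Qed.

Lemma Cintegral_mul_l m L z g :
  Cintegral_lvl m L (fun x => (z * g x)%Cx) = (z * Cintegral_lvl m L g)%Cx.
Proof.
  apply Cx_eq; unfold Cintegral_lvl, Cmul; simpl.
  - replace (fun x => fst z * fst (g x) - snd z * snd (g x))
      with (fun x => fst z * fst (g x) + (- snd z) * snd (g x))
      by (apply functional_extensionality; intros; ring).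
    rewrite integral_plus, !integral_mul_l; ring.
  - rewrite integral_plus, !integral_mul_l; ring.
Qed.

Lemma Cintegral_S m (hm : forall k, (2 <= m k)%nat) L g :
  Cintegral_lvl m (S L) g
  = Cintegral_lvl m L (fun x => Cscal (/ INR (m L)) (Csum (m L) (fun a => g (upd x L a)))).
Proof.
  unfold Cintegral_lvl; rewrite !integral_S by exact hm; f_equal;
    apply integral_ext; auto; intros x _; unfold Cscal; simpl;
    [rewrite fst_Csum | rewrite snd_Csum]; reflexivity.
Qed.

Lemma Cintegral_prod m (hm : forall k, (2 <= m k)%nat) L (h : nat -> nat -> Cx) :
  Cintegral_lvl m L (fun x => Cprod L (fun k => h k (x k)))
  = Cprod L (fun k => Cscal (/ INR (m k)) (Csum (m k) (h k))).
Proof.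
  induction L as [ | L IH].
  { unfold Cintegral_lvl, integral_lvl, Cprod, C1; simpl; f_equal; lra. }
  rewrite Cintegral_S by exact hm; rewrite (Cprod_S L), <- IH.
  replace (Cintegral_lvl m L (fun x => Cprod L (fun k => h k (x k)))
           * Cscal (/ INR (m L)) (Csum (m L) (h L)))%Cx
    with (Cscal (/ INR (m L)) (Csum (m L) (h L))
          * Cintegral_lvl m L (fun x => Cprod L (fun k => h k (x k))))%Cx by ring.
  rewrite <- Cintegral_mul_l; apply Cintegral_ext; auto; intros x _.
  rewrite !Cscal_RC.
  rewrite (Csum_ext _ _ (fun a => (Cprod L (fun k => h k (x k)) * h L a)%Cx)).
  - rewrite Csum_mul_l; ring.
  - intros a _; rewrite Cprod_S; unfold upd at 2; rewrite Nat.eqb_refl; f_equal.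
    apply Cprod_ext; intros k Hk; unfold upd; destruct (Nat.eqb_spec k L); [lia | reflexivity].
Qed.

(** The summands are the powers of [w = exp(2 pi i (j - i) / m_k)], an [m_k]-th root of unity that
    is trivial only for [i = j]. *)
Lemma rad_orthogonal (m : nat -> nat) (hm : forall k, (2 <= m k)%nat) k i j :
  (i < m k)%nat -> (j < m k)%nat ->
  let r := fun a => Cexpi (2 * PI * INR a / INR (m k)) in
  Cscal (/ INR (m k)) (Csum (m k) (fun a => (Cpow (r a) j * Cconj (Cpow (r a) i))%Cx))
  = if Nat.eqb i j then C1 else C0.
Proof.
  intros Hi Hj r; pose proof (INR_m_pos m hm k) as Hm; pose proof PI_RGT_0.
  set (w := Cexpi ((INR j - INR i) * (2 * PI) / INR (m k))).
  rewrite (Csum_ext _ _ (Cpow w)).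
  2:{ intros a _; unfold r, w; rewrite !Cpow_expi, <- Cexpi_opp, <- Cexpi_add.
      f_equal; field; lra. }
  destruct (Nat.eqb_spec i j) as [-> | Hne].
  - replace w with C1.
    + rewrite (Csum_ext _ _ (fun _ => C1)) by (intros; apply Cpow_C1).
      rewrite Csum_const, Cscal_RC; apply Cx_eq; unfold RC, Cmul, C1; simpl; field; lra.
    + unfold w; replace ((INR j - INR j) * (2 * PI) / INR (m k)) with 0 by (field; lra).
      symmetry; apply Cexpi_0.
  - assert (Hb : forall a b, (a < b)%nat -> (b < m k)%nat ->
      0 < (INR b - INR a) * (2 * PI) / INR (m k) < 2 * PI).
    { intros a b Hab Hbm; apply lt_INR in Hab; apply lt_INR in Hbm; pose proof (pos_INR a).
      split; [apply Rdiv_lt_0_compat; nra | ].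
      apply Rmult_lt_reg_r with (INR (m k)); [lra | ].
      unfold Rdiv; rewrite Rmult_assoc, Rinv_l by lra; nra. }
    rewrite geom_sum_root_of_unity.
    + rewrite Cscal_RC; ring.
    + unfold w; rewrite Cpow_expi.
      replace (INR (m k) * ((INR j - INR i) * (2 * PI) / INR (m k)))
        with (INR j * (2 * PI) + - (INR i * (2 * PI))) by (field; lra).
      rewrite Cexpi_add, Cexpi_opp, !Cexpi_2PI_mult, Cconj_C1; ring.
    + destruct (Nat.lt_gt_cases i j) as [[Hij | Hij] _]; [exact Hne | | ].
      * apply Cexpi_neq1, Hb; assumption.
      (* For [j < i] the angle is negative; pass to the conjugate, whose angle lies in
         [(0, 2 pi)]. *)
      * intros E; apply (Cexpi_neq1 ((INR i - INR j) * (2 * PI) / INR (m k))).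
        { apply Hb; assumption. }
        replace ((INR i - INR j) * (2 * PI) / INR (m k))
          with (- ((INR j - INR i) * (2 * PI) / INR (m k))) by (field; lra).
        rewrite Cexpi_opp; fold w; rewrite E; apply Cconj_C1.
Qed.

(** The integrand factors over the coordinates, and distinct indices below [M_L] differ in some
    digit, whose factor integrates to 0. *)
Lemma psi_orthonormal m (hm : forall k, (2 <= m k)%nat) L i j :
  (i < Mk m L)%nat -> (j < Mk m L)%nat ->
  Cintegral_lvl m L (fun x => (psi m j x * Cconj (psi m i x))%Cx)
  = if Nat.eqb i j then C1 else C0.
Proof.
  intros Hi Hj.
  set (r := fun k a => Cexpi (2 * PI * INR a / INR (m k))).
  set (h := fun k a => (Cpow (r k a) (digit m j k) * Cconj (Cpow (r k a) (digit m i k)))%Cx).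
  rewrite (Cintegral_ext m hm L _ (fun x => Cprod L (fun k => h k (x k)))).
  2:{ intros x _; rewrite !(psi_prod m hm _ L) by assumption.
      rewrite Cprod_conj, <- Cprod_mul; reflexivity. }
  rewrite Cintegral_prod by exact hm.
  assert (Hd : forall n k, (digit m n k < m k)%nat)
    by (intros n k; apply Nat.mod_upper_bound; specialize (hm k); lia).
  destruct (Nat.eqb_spec i j) as [-> | Hne].
  - apply Cprod_one; intros k _; unfold h, r.
    rewrite rad_orthogonal, Nat.eqb_refl by auto; reflexivity.
  - assert (Hk : exists k, (k < L)%nat /\ digit m i k <> digit m j k).
    { apply NNPP; intros H; apply Hne, (digit_inj m hm L); auto.
      intros k Hk; apply NNPP; intros Hk'; apply H; exists k; auto. }
    destruct Hk as [k [Hk Hk']]; apply Cprod_zero with k; [exact Hk | ].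
    unfold h, r; rewrite rad_orthogonal by auto.
    destruct (Nat.eqb_spec (digit m i k) (digit m j k)); [contradiction | reflexivity].
Qed.

(** An eventually constant sequence converges, so [epsilon] returns a genuine limit, and limits are
    unique. *)
Lemma fourier_eq m (f : nat -> (nat -> nat) -> Cx) i c K :
  (forall k, (K <= k)%nat ->
     Cintegral_lvl m (k + S i) (fun x => (f k x * Cconj (psi m i x))%Cx) = c) ->
  fourier m f i = c.
Proof.
  intros H; unfold fourier.
  set (u := fun k => Cintegral_lvl m (k + S i) (fun x => (f k x * Cconj (psi m i x))%Cx)).
  assert (Hc : Ccv u c).
  { split; intros eps Heps; exists K; intros n Hn; unfold u; rewrite H by exact Hn;
      rewrite R_dist_eq; exact Heps. }
  destruct (epsilon_spec (inhabits C0) (Ccv u) (ex_intro _ c Hc)) as [H1 H2].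
  destruct Hc as [H3 H4]; apply Cx_eq; eapply UL_sequence; eassumption.
Qed.

Lemma fourier_partial_sum m (hm : forall k, (2 <= m k)%nat) (g : nat -> Cx) i :
  fourier m (fun n x => Csum (Mk m n) (fun j => (g j * psi m j x)%Cx)) i = g i.
Proof.
  (* For [k > i] one has [i < k < M_k], so frequency [i] already occurs in the [k]-th sum and the
     coefficient no longer changes. *)
  apply fourier_eq with (K := S i); intros k Hk; set (L := (k + S i)%nat).
  pose proof (Mk_gt m hm k); pose proof (Mk_mono m hm k L ltac:(lia)).
  rewrite (Cintegral_ext m hm L _
    (fun x => Csum (Mk m k) (fun j => (g j * (psi m j x * Cconj (psi m i x)))%Cx))).
  2:{ intros x _.
      replace (Csum (Mk m k) (fun j => (g j * psi m j x)%Cx) * Cconj (psi m i x))%Cx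
        with (Cconj (psi m i x) * Csum (Mk m k) (fun j => (g j * psi m j x)%Cx))%Cx by ring.
      rewrite <- Csum_mul_l; apply Csum_ext; intros; ring. }
  rewrite Cintegral_Csum, (Csum_delta _ i).
  - rewrite Cintegral_mul_l, psi_orthonormal, Nat.eqb_refl by (auto; lia); ring.
  - lia.
  - intros j Hj Hji; rewrite Cintegral_mul_l, psi_orthonormal by (auto; lia).
    destruct (Nat.eqb_spec i j); [congruence | ring].
Qed.

(** * The gliding hump *)

(* The greedy construction behind [sparse_weights]: the state before step [A] is the number [k]
   of nonzero weights chosen so far and the accumulated sum [c] of [s^2 w]; step [A] receives the
   weight [(1/2)^k] as soon as [h A] is large compared with [k] and [c]. *)
Definition greedy_test (h : nat -> R) (A : nat) (st : nat * R) :=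
  Rle_dec (INR (fst st) + 1 + sqrt (snd st)) ((1/2) ^ fst st * h A).
Definition greedy_weight (h : nat -> R) (A : nat) (st : nat * R) : R :=
  if greedy_test h A st then (1/2) ^ fst st else 0.
Fixpoint greedy_state (h w : nat -> R) (A : nat) : nat * R :=
  match A with
  | O => (O, 0)
  | S A =>
      let st := greedy_state h w A in
      if greedy_test h A st then (S (fst st), snd st + ((1/2) ^ fst st) ^ 2 * w A) else st
  end.

(** Induction on the distance [d] to an index that would pass: a failed test leaves the state
    unchanged, so that index stays eligible until some test succeeds. *)
Lemma greedy_state_pick h w A d :
  (INR (fst (greedy_state h w A)) + 1 + sqrt (snd (greedy_state h w A))
   <= (1/2) ^ fst (greedy_state h w A) * h (A + d)%nat) ->
  exists A', greedy_state h w A' = greedy_state h w A /\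
    INR (fst (greedy_state h w A')) + 1 + sqrt (snd (greedy_state h w A'))
    <= (1/2) ^ fst (greedy_state h w A') * h A'.
Proof.
  revert A; induction d as [ | d IH]; intros A H.
  - rewrite Nat.add_0_r in H; exists A; auto.
  - destruct (greedy_test h A (greedy_state h w A)) as [Ht | Ht] eqn:E; [exists A; auto | ].
    assert (Es : greedy_state h w (S A) = greedy_state h w A) by (simpl; rewrite E; reflexivity).
    destruct (IH (S A)) as [A' [H1 H2]].
    + rewrite Es; replace (S A + d)%nat with (A + S d)%nat by lia; exact H.
    + exists A'; rewrite <- Es at 1; auto.
Qed.

(** The nonzero weights are [1, 1/2, 1/4, ...] in order of selection, so after [k] selections their
    sum is geometric. *)
Lemma greedy_state_sums h w A :
  let s := fun A => greedy_weight h A (greedy_state h w A) in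
  Rsum A s = 2 - 2 * (1/2) ^ fst (greedy_state h w A) /\
  Rsum A (fun j => s j ^ 2 * w j) = snd (greedy_state h w A).
Proof.
  intros s; induction A as [ | A [IH1 IH2]]; [simpl; split; lra | ].
  change (Rsum (S A) s) with (Rsum A s + s A).
  change (Rsum (S A) (fun j => s j ^ 2 * w j))
    with (Rsum A (fun j => s j ^ 2 * w j) + s A ^ 2 * w A).
  rewrite IH1, IH2; unfold s, greedy_weight; simpl greedy_state.
  destruct (greedy_test h A (greedy_state h w A)); cbn [fst snd pow]; split; lra.
Qed.

(** Here [h A] is to measure the growth of hump [A] and [w] the size of the earlier humps. The last
    clause lets a hump beat all its predecessors by any margin [K]; the clause on [h A <= 0] is what
    makes the weight at 0 vanish. *)
Lemma sparse_weights (h w : nat -> R) :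
  (forall K N, exists A, (N <= A)%nat /\ K <= h A) ->
  exists s : nat -> R,
    (forall A, 0 <= s A) /\ (forall A, h A <= 0 -> s A = 0) /\
    (forall N, Rsum N s <= 2) /\
    forall K, exists A, K + sqrt (Rsum A (fun j => s j ^ 2 * w j)) <= s A * h A.
Proof.
  intros Hh; exists (fun A => greedy_weight h A (greedy_state h w A)).
  assert (Hp : forall k, 0 < (1/2) ^ k) by (intros; apply pow_lt; lra).
  split; [ | split; [ | split]].
  - intros A; unfold greedy_weight; destruct (greedy_test _ _ _); [left; auto | lra].
  - intros A HA; unfold greedy_weight; destruct (greedy_test _ _ _) as [H | H]; [ | reflexivity].
    set (k := fst (greedy_state h w A)) in *.
    pose proof (pos_INR k); pose proof (sqrt_pos (snd (greedy_state h w A))).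
    specialize (Hp k); nra.
  - intros N; rewrite (proj1 (greedy_state_sums h w N)).
    specialize (Hp (fst (greedy_state h w N))); lra.
  - assert (Hpick : forall A, exists A', greedy_state h w A' = greedy_state h w A /\
      INR (fst (greedy_state h w A')) + 1 + sqrt (snd (greedy_state h w A'))
      <= (1/2) ^ fst (greedy_state h w A') * h A').
    { intros A; set (st := greedy_state h w A).
      destruct (Hh ((INR (fst st) + 1 + sqrt (snd st)) / (1/2) ^ fst st) A) as [A1 [H1 H2]].
      apply (greedy_state_pick h w A (A1 - A)).
      replace (A + (A1 - A))%nat with A1 by lia; fold st.
      apply (Rmult_le_compat_l ((1/2) ^ fst st)) in H2; [ | left; auto].
      eapply Rle_trans; [ | exact H2]; right; field.
      apply Rgt_not_eq, Hp. }
    assert (Hk : forall k, exists A, fst (greedy_state h w A) = k).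
    { induction k as [ | k [A HA]]; [exists 0%nat; reflexivity | ].
      destruct (Hpick A) as [A' [E Ht]]; exists (S A'); simpl.
      destruct (greedy_test h A' (greedy_state h w A')) as [_ | n]; [ | contradiction].
      simpl; rewrite E, HA; reflexivity. }
    (* Take a state with [k > K] selections made; the next successful test reads
       [k + 1 + sqrt c <= s A * h A]. *)
    intros K; destruct (INR_unbounded K) as [k HK]; destruct (Hk k) as [A HA].
    destruct (Hpick A) as [A' [E Ht]]; exists A'.
    rewrite (proj2 (greedy_state_sums h w A')); unfold greedy_weight.
    destruct (greedy_test h A' (greedy_state h w A')) as [_ | n]; [ | contradiction].
    rewrite E, HA in *; lra.
Qed.

(** * Frequency blocks and the martingale *)

Fixpoint lvl (m : nat -> nat) (i : nat) : nat :=
  match i with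
  | O => O
  | S i => if Nat.eqb (S i) (Mk m (S (lvl m i))) then S (lvl m i) else lvl m i
  end.

(** A new block begins exactly when the index reaches the next [M_A]. The condition [1 <= i] is
    there because [lvl] puts index 0 into block 0 although [M_0 = 1]. *)
Lemma lvl_spec m (hm : forall k, (2 <= m k)%nat) i :
  (i < Mk m (S (lvl m i)))%nat /\ ((1 <= i)%nat -> (Mk m (lvl m i) <= i)%nat).
Proof.
  induction i as [ | i [IH1 IH2]].
  - split; [pose proof (Mk_pos m hm (S (lvl m 0))); lia | lia].
  - cbn [lvl]; destruct (Nat.eqb_spec (S i) (Mk m (S (lvl m i)))) as [E | E].
    + pose proof (Mk_double m hm (S (lvl m i))); lia.
    + split; [lia | intros _]; destruct i; [simpl; lia | lia].
Qed.

Lemma lvl_eq m (hm : forall k, (2 <= m k)%nat) i A :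
  (Mk m A <= i)%nat -> (i < Mk m (S A))%nat -> lvl m i = A.
Proof.
  intros H1 H2; pose proof (Mk_pos m hm A); destruct (lvl_spec m hm i) as [H3 H4].
  specialize (H4 ltac:(lia)).
  destruct (Nat.lt_trichotomy (lvl m i) A) as [Hl | [Hl | Hl]]; [ | exact Hl | ];
    pose proof (Mk_mono m hm _ _ Hl); lia.
Qed.

(* [psums m c n] is the [n]-th Vilenkin partial sum of the series
   [sum_A c_A (D_{M_(A+1)} - D_{M_A})] (plus the constant [c_0]). *)
Definition psums (m : nat -> nat) (c : nat -> R) (n : nat) (x : nat -> nat) : Cx :=
  Csum n (fun j => (RC (c (lvl m j)) * psi m j x)%Cx).
Definition mart (m : nat -> nat) (c : nat -> R) (n : nat) (x : nat -> nat) : Cx :=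
  psums m c (Mk m n) x.

Lemma psums_block m (hm : forall k, (2 <= m k)%nat) c A k x :
  (Mk m A + k <= Mk m (S A))%nat ->
  psums m c (Mk m A + k) x
  = (psums m c (Mk m A) x
     + RC (c A) * Csum k (fun j => psi m (Mk m A + j) x))%Cx.
Proof.
  intros Hk; unfold psums; rewrite Csum_split, <- Csum_mul_l; f_equal.
  apply Csum_ext; intros j Hj; rewrite (lvl_eq m hm _ A) by lia; reflexivity.
Qed.

(** The martingale difference is [c_n (D_{M_{n+1}} - D_{M_n})], and [D_{M_{n+1}}] is the geometric
    sum in [r_n] times [D_{M_n}]. *)
Lemma mart_S m (hm : forall k, (2 <= m k)%nat) c n x :
  let e := fun k => psi m k x in
  mart m c (S n) x
  = (mart m c n x + RC (c n) * ((Csum (m n) (Cpow (rad m n x)) - C1) * dker e (Mk m n)))%Cx.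
Proof.
  intros e; unfold mart; pose proof (Mk_double m hm n).
  replace (Mk m (S n)) with (Mk m n + (Mk m (S n) - Mk m n))%nat at 1 by lia.
  rewrite psums_block by (auto; lia); f_equal; f_equal.
  assert (E : (dker e (Mk m n) + Csum (Mk m (S n) - Mk m n) (fun j => psi m (Mk m n + j) x)
               = Csum (m n) (Cpow (rad m n x)) * dker e (Mk m n))%Cx).
  { unfold e; rewrite <- dker_psi_mul by auto; unfold dker; rewrite <- Csum_split.
    f_equal; simpl in *; lia. }
  replace ((Csum (m n) (Cpow (rad m n x)) - C1) * dker e (Mk m n))%Cx
    with (Csum (m n) (Cpow (rad m n x)) * dker e (Mk m n) - dker e (Mk m n))%Cx by ring.
  rewrite <- E; ring.
Qed.

Lemma inG_upd m x n a : inG m x -> (a < m n)%nat -> inG m (upd x n a).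
Proof.
  intros Hx Ha k; unfold upd; destruct (Nat.eqb_spec k n) as [-> | _]; auto.
Qed.

Lemma mart_local m (hm : forall k, (2 <= m k)%nat) c n x y :
  (forall j, (j < n)%nat -> x j = y j) -> mart m c n x = mart m c n y.
Proof.
  intros H; unfold mart, psums; apply Csum_ext; intros j Hj.
  rewrite (psi_local m hm n j x y H Hj); reflexivity.
Qed.

(** As coordinate [n] runs over [Z_{m_n}], the geometric sum in [mart_S] equals [m_n] once and 0
    otherwise; its average is 1, so the difference averages to 0. *)
Lemma is_martingale_mart m (hm : forall k, (2 <= m k)%nat) c : is_martingale m (mart m c).
Proof.
  split.
  - intros n x y _ _ H; apply mart_local; auto.
  - intros n x Hx; set (D := dker (fun k => psi m k x) (Mk m n)).
    assert (Hu : forall a j, (j < n)%nat -> upd x n a j = x j).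
    { intros a j Hj; unfold upd; destruct (Nat.eqb_spec j n); [lia | reflexivity]. }
    rewrite (Csum_ext _ _ (fun a => (mart m c n x
      + RC (c n) * D * ((if Nat.eqb a 0 then RC (INR (m n)) else C0) - C1))%Cx)).
    + rewrite Csum_add, Csum_const, Csum_mul_l; unfold Csub.
      rewrite Csum_add, Csum_const.
      rewrite (Csum_delta _ 0) by (first [specialize (hm n); lia |
        intros k _ Hk; destruct (Nat.eqb_spec k 0); [contradiction | reflexivity]]).
      simpl Nat.eqb; cbv iota; rewrite Cscal_RC.
      replace (RC (/ INR (m n)) *
        (RC (INR (m n)) * mart m c n x
         + RC (c n) * D * (RC (INR (m n)) + RC (INR (m n)) * - C1)))%Cx
        with (RC (/ INR (m n)) * RC (INR (m n)) * mart m c n x)%Cx by ring.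
      pose proof (INR_m_pos m hm n).
      rewrite <- RC_mult, Rinv_l by lra; change (RC 1) with C1; ring.
    + intros a Ha; rewrite mart_S by exact hm.
      rewrite (mart_local m hm c n _ x) by (intros; apply Hu; lia).
      rewrite Csum_rad_pow by (auto; apply inG_upd; auto).
      unfold upd at 1; rewrite Nat.eqb_refl; unfold D, dker.
      rewrite (Csum_ext (Mk m n) (fun k => psi m k (upd x n a)) (fun k => psi m k x)); [ring | ].
      intros k Hk; apply (psi_local m hm n); auto.
Qed.

(** [D_{M_A}] is [M_A] on [I_A(0)] and 0 elsewhere, and the other factor of each difference has
    modulus [m_A - 1] or 1, at most [m_A]. *)
Lemma Cnorm_mart_le m (hm : forall k, (2 <= m k)%nat) c n L x :
  inG m x -> (forall A, 0 <= c A) -> c 0%nat = 0 -> (n <= L)%nat ->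
  Cnorm (mart m c n x) <= Rsum n (fun A => c A * INR (Mk m (S A)) * box (cosetP A) L x).
Proof.
  intros Hx Hc Hc0; induction n as [ | n IH]; intros HL.
  - unfold mart, psums; simpl Mk; rewrite Csum_S; simpl lvl; rewrite Hc0.
    unfold Csum; simpl; replace (C0 + RC 0 * psi m 0 x)%Cx with C0; [rewrite Cnorm_C0; lra | ].
    change (RC 0) with C0; ring.
  - rewrite mart_S by exact hm; cbn [Rsum]; eapply Rle_trans; [apply Cnorm_add | ].
    apply Rplus_le_compat; [apply IH; lia | ].
    rewrite Cnorm_mul, Cnorm_RC, (Rabs_pos_eq (c n)), Rmult_assoc by auto.
    apply Rmult_le_compat_l; [auto | ].
    pose proof (INR_Mk_pos m hm n) as HM; pose proof (INR_m_pos m hm n) as Hm.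
    assert (Hm2 : 2 <= INR (m n)) by (apply (le_INR 2), hm).
    destruct (classic (forall j, (j < n)%nat -> x j = 0%nat)) as [H0 | H0].
    + rewrite box_eq1.
      2:{ intros k Hk; unfold cosetP; destruct (Nat.leb_spec n k); [reflexivity | ].
          rewrite H0 by lia; reflexivity. }
      rewrite dker_psi_Mk, Csum_rad_pow, Cnorm_mul, Cnorm_RC by auto.
      rewrite Rabs_pos_eq by lra; simpl Mk; rewrite mult_INR, Rmult_1_r.
      apply Rmult_le_compat_r; [lra | ].
      destruct (Nat.eqb (x n) 0).
      * replace (RC (INR (m n)) - C1)%Cx with (RC (INR (m n) - 1)).
        { rewrite Cnorm_RC, Rabs_pos_eq; lra. }
        apply Cx_eq; unfold RC, Csub, Copp, Cadd, C1; simpl; ring.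
      * replace (C0 - C1)%Cx with (- C1)%Cx by ring; rewrite Cnorm_opp, Cnorm_C1; lra.
    + apply not_all_ex_not in H0 as [j Hj]; apply imply_to_and in Hj as [Hj Hxj].
      rewrite (dker_psi_Mk_eq0 m hm n x j), Cnorm_mul, Cnorm_C0 by auto.
      pose proof (INR_Mk_pos m hm (S n)).
      destruct (box_01 (cosetP n) L x) as [[-> _] | ->]; lra.
Qed.

Lemma maxupto_le N h b : (forall n, (n <= N)%nat -> h n <= b) -> maxupto N h <= b.
Proof.
  induction N as [ | N IH]; intros H; simpl; [auto | apply Rmax_lub; auto].
Qed.

(* [c_A = s_A^2 M_A] makes [mart m c] the sum of [s_A^2] times atoms of [H_{1/2}]. *)
Definition coeffs (m : nat -> nat) (s : nat -> R) (A : nat) : R := s A ^ 2 * INR (Mk m A).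

Lemma in_H_half_mart m (hm : forall k, (2 <= m k)%nat) B s :
  (forall k, (m k <= B)%nat) -> (forall A, 0 <= s A) -> s 0%nat = 0 ->
  (forall N, Rsum N s <= 2) -> in_H_half m (mart m (coeffs m s)).
Proof.
  intros HB Hs Hs0 Hsum; split; [apply is_martingale_mart, hm | ].
  assert (Hc : forall A, 0 <= coeffs m s A).
  { intros A; pose proof (INR_Mk_pos m hm A); pose proof (pow2_ge_0 (s A)); unfold coeffs; nra. }
  assert (Hc0 : coeffs m s 0%nat = 0) by (unfold coeffs; rewrite Hs0; simpl; ring).
  (* Term [A] integrates to at most [sqrt(m_A) s_A <= B s_A], and the weights sum to at most 2. *)
  exists (INR B * 2); intros N.
  set (b := fun A x => coeffs m s A * INR (Mk m (S A)) * box (cosetP A) N x).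
  assert (Hb : forall A x, 0 <= b A x).
  { intros A x; unfold b; pose proof (INR_Mk_pos m hm (S A)); specialize (Hc A).
    assert (0 <= coeffs m s A * INR (Mk m (S A))) by nra.
    destruct (box_01 (cosetP A) N x) as [[-> _] | ->]; lra. }
  eapply Rle_trans.
  { apply integral_le with (h := fun x => Rsum N (fun A => sqrt (b A x))); [exact hm | ].
    intros x Hx; eapply Rle_trans; [ | apply sqrt_Rsum_le; auto].
    apply sqrt_le_1_alt, maxupto_le; intros n Hn.
    eapply Rle_trans; [apply Cnorm_mart_le with (L := N); auto | ].
    apply (Rsum_mono n N (fun A => b A x)); auto. }
  rewrite integral_Rsum; eapply Rle_trans; [ | apply Rmult_le_compat_l; [apply pos_INR | apply (Hsum N)]].
  rewrite <- Rsum_mul_l; apply Rsum_le; intros A HA.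
  pose proof (INR_Mk_pos m hm A) as HM; pose proof (INR_m_pos m hm A) as Hm.
  assert (HmB : INR (m A) <= INR B) by (apply le_INR, HB).
  assert (Hm1 : 1 <= INR (m A)) by (apply (le_INR 1); specialize (hm A); lia).
  eapply Rle_trans.
  { apply integral_le with (h := fun x => (INR B * s A * INR (Mk m A)) * box (cosetP A) N x);
      [exact hm | ]; intros x _; unfold b.
    destruct (box_01 (cosetP A) N x) as [[-> _] | ->]; rewrite ?Rmult_0_r, ?Rmult_1_r.
    2: rewrite sqrt_0; lra.
    assert (Hpos : 0 <= INR B * s A * INR (Mk m A))
      by (apply Rmult_le_pos; [apply Rmult_le_pos; [lra | auto] | lra]).
    rewrite <- (sqrt_Rsqr (INR B * s A * INR (Mk m A))) by exact Hpos.
    apply sqrt_le_1_alt; unfold coeffs; simpl Mk; rewrite mult_INR; unfold Rsqr.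
    replace (s A ^ 2 * INR (Mk m A) * (INR (m A) * INR (Mk m A)))
      with ((s A * INR (Mk m A)) ^ 2 * INR (m A)) by ring.
    replace (INR B * s A * INR (Mk m A) * (INR B * s A * INR (Mk m A)))
      with ((s A * INR (Mk m A)) ^ 2 * (INR B * INR B)) by ring.
    apply Rmult_le_compat_l; [apply pow2_ge_0 | nra]. }
  rewrite integral_mul_l, integral_coset by (auto; lia); right; field; lra.
Qed.

(** Block [j] has fewer than [M_{j+1}] frequencies, each with coefficient [c_j]. The bound is crude,
    but it depends on [A] alone and not on [k]. *)
Lemma Cnorm_psums_le m (hm : forall k, (2 <= m k)%nat) c A k x :
  (forall A, 0 <= c A) -> c 0%nat = 0 -> (k <= Mk m A)%nat ->
  Cnorm (psums m c k x) <= Rsum A (fun j => c j * INR (Mk m (S j))).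
Proof.
  intros Hc Hc0; revert k; induction A as [ | A IH]; intros k Hk.
  - simpl in Hk; unfold psums; eapply Rle_trans; [apply Cnorm_Csum_le | ].
    simpl; replace 0 with (Rsum k (fun _ => 0)) by (rewrite Rsum_const; ring).
    apply Rsum_le; intros j Hj; replace j with 0%nat by lia; simpl lvl.
    rewrite Hc0, Cnorm_mul, Cnorm_RC, Rabs_R0; lra.
  - cbn [Rsum]; pose proof (INR_Mk_pos m hm (S A)); specialize (Hc A) as HcA.
    destruct (Nat.le_ge_cases k (Mk m A)) as [H1 | H1].
    + specialize (IH k H1); nra.
    + replace k with (Mk m A + (k - Mk m A))%nat by lia.
      rewrite psums_block by (auto; lia).
      eapply Rle_trans; [apply Cnorm_add | ]; apply Rplus_le_compat; [apply IH; lia | ].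
      rewrite Cnorm_mul, Cnorm_RC, Rabs_pos_eq by auto; apply Rmult_le_compat_l; [auto | ].
      eapply Rle_trans; [apply Cnorm_Csum_le | ].
      eapply Rle_trans; [apply (Rsum_le _ _ (fun _ => 1)); intros; rewrite Cnorm_psi; lra | ].
      rewrite Rsum_const, Rmult_1_r; apply le_INR; lia.
Qed.

Lemma fejer_mart m (hm : forall k, (2 <= m k)%nat) c n x :
  fejer m (mart m c) n x = Cscal (/ INR n) (Csum n (fun k => psums m c k x)).
Proof.
  unfold fejer; f_equal; apply Csum_ext; intros k _; unfold partial_sum, psums.
  apply Csum_ext; intros j _; f_equal.
  exact (fourier_partial_sum m hm (fun j => RC (c (lvl m j))) j).
Qed.

Lemma Cnorm_fejer_mart_ge m (hm : forall k, (2 <= m k)%nat) c A N x :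
  (forall A, 0 <= c A) -> c 0%nat = 0 -> (N <= Mk m A)%nat ->
  c A / INR (Mk m A + N) * Cnorm (fker (fun k => psi m k x) N)
  <= Cnorm (fejer m (mart m c) (Mk m A + N) x)
     + Rsum A (fun j => c j * INR (Mk m (S j))).
Proof.
  intros Hc Hc0 HN; rewrite fejer_mart by exact hm.
  set (n := (Mk m A + N)%nat); set (C := Rsum A (fun j => c j * INR (Mk m (S j)))).
  pose proof (Mk_pos m hm A); pose proof (Mk_double m hm A).
  assert (Hn : 0 < INR n) by (apply lt_0_INR; unfold n; lia).
  (* [n sigma_n f] splits into [U], which involves only blocks below [A], and [V], the contribution
     of block [A]. As [N <= M_A], no frequency of a later block occurs. *)
  set (U := (Csum (Mk m A) (fun k => psums m c k x)
             + RC (INR N) * psums m c (Mk m A) x)%Cx).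
  set (V := (RC (c A) * psi m (Mk m A) x * fker (fun k => psi m k x) N)%Cx).
  assert (E : Csum n (fun k => psums m c k x) = (U + V)%Cx).
  { unfold n, U, V, fker; rewrite Csum_split, <- Csum_const, <- Csum_mul_l.
    rewrite (Csum_ext N (fun k => psums m c (Mk m A + k) x)
      (fun k => (psums m c (Mk m A) x
         + RC (c A) * psi m (Mk m A) x * dker (fun k => psi m k x) k)%Cx)).
    - rewrite Csum_add; ring.
    - intros k Hk; rewrite psums_block by (auto; lia); f_equal; unfold dker.
      rewrite <- Csum_mul_l, <- Csum_mul_l; apply Csum_ext; intros j Hj.
      pose proof (psi_add m hm 1 j A x) as Ep; rewrite !Nat.mul_1_l in Ep.
      rewrite Ep by lia; ring. }
  assert (HU : Cnorm U <= INR n * C).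
  { unfold U, n; rewrite plus_INR, Rmult_plus_distr_r.
    eapply Rle_trans; [apply Cnorm_add | ]; apply Rplus_le_compat.
    - eapply Rle_trans; [apply Cnorm_Csum_le | ]; rewrite <- Rsum_const.
      apply Rsum_le; intros k Hk; apply Cnorm_psums_le; auto; lia.
    - rewrite Cnorm_mul, Cnorm_RC, Rabs_pos_eq by apply pos_INR.
      apply Rmult_le_compat_l; [apply pos_INR | apply Cnorm_psums_le; auto]. }
  assert (HV : Cnorm V = c A * Cnorm (fker (fun k => psi m k x) N)).
  { unfold V; rewrite !Cnorm_mul, Cnorm_RC, Cnorm_psi, Rabs_pos_eq by auto; ring. }
  pose proof (Cnorm_add (U + V) (- U)) as T; rewrite Cnorm_opp in T.
  replace (U + V + - U)%Cx with V in T by ring.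
  rewrite E, Cscal_RC, Cnorm_mul, Cnorm_RC, Rabs_pos_eq by (left; apply Rinv_0_lt_compat, Hn).
  apply Rmult_le_reg_l with (INR n); [exact Hn | ].
  replace (INR n * (c A / INR n * Cnorm (fker (fun k => psi m k x) N))) with (Cnorm V)
    by (rewrite HV; field; lra).
  replace (INR n * (/ INR n * Cnorm (U + V) + C)) with (Cnorm (U + V) + INR n * C)
    by (field; lra).
  lra.
Qed.

(** * Lower bound for the Fejer mean at a lacunary index *)

Fixpoint spread (m : nat -> nat) (T : nat) : nat :=
  match T with O => O | S T => (spread m T + Mk m (S (2 * T)))%nat end.

Lemma spread_lt m (hm : forall k, (2 <= m k)%nat) T : (spread m T < Mk m (2 * T))%nat.
Proof.
  induction T as [ | T IH]; [simpl; lia | ].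
  replace (2 * S T)%nat with (S (S (2 * T))) by lia; cbn [spread].
  pose proof (Mk_double m hm (2 * T)); pose proof (Mk_double m hm (S (2 * T))); lia.
Qed.

(** The terms above [M_{2i+1}] are [M_{2j+1}] with [j > i], all multiples of [M_{2i+2}]. This is the
    shape required by [fker_psi_lower_bound] at [l = 2i]. *)
Lemma spread_decomp m T i : (i < T)%nat ->
  exists q, spread m T
    = (q * Mk m (S (S (2 * i))) + (Mk m (S (2 * i)) + spread m i))%nat.
Proof.
  intros H; induction H as [ | T H [q IH]]; [exists 0%nat; cbn [spread]; lia | ].
  destruct (Mk_divide m (S (S (2 * i))) (S (2 * T)) ltac:(lia)) as [p Hp].
  exists (q + p)%nat; cbn [spread]; rewrite IH, Hp; lia.
Qed.

Lemma integral_sqrt_fejer_ge m (hm : forall k, (2 <= m k)%nat) s A :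
  (forall A, 0 <= s A) -> s 0%nat = 0 ->
  let n := (Mk m A + spread m (A / 2))%nat in
  s A * INR (A / 2) / 8
  <= integral_lvl m n (fun x => sqrt (Cnorm (fejer m (mart m (coeffs m s)) n x)))
     + sqrt (Rsum A (fun j => s j ^ 2 * (INR (Mk m j) * INR (Mk m (S j))))).
Proof.
  intros Hs Hs0 n; set (T := (A / 2)%nat) in *.
  assert (HT : (2 * T <= A)%nat) by (apply Nat.Div0.mul_div_le).
  set (C := Rsum A (fun j => s j ^ 2 * (INR (Mk m j) * INR (Mk m (S j))))).
  assert (Hc : forall A, 0 <= coeffs m s A).
  { intros A'; pose proof (INR_Mk_pos m hm A'); pose proof (pow2_ge_0 (s A')); unfold coeffs; nra. }
  assert (Hc0 : coeffs m s 0%nat = 0) by (unfold coeffs; rewrite Hs0; simpl; ring).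
  assert (EC : C = Rsum A (fun j => coeffs m s j * INR (Mk m (S j)))).
  { unfold C; f_equal; apply functional_extensionality; intros j; unfold coeffs; ring. }
  assert (HC : 0 <= C).
  { rewrite EC; apply Rsum_ge0; intros k _; pose proof (INR_Mk_pos m hm (S k)).
    specialize (Hc k); nra. }
  pose proof (spread_lt m hm T); pose proof (Mk_mono m hm _ _ HT); pose proof (Mk_gt m hm A).
  set (y := fun x => Cnorm (fejer m (mart m (coeffs m s)) n x)).
  (* On the shell at level [l] one gets [y x + C >= (s_A^2 / 2) (M_l^2 / 2)], whose root is
     [s_A M_l / 2]. Integrating, each of the [T] shells yields at least [(s_A / 2) / 4], hence the
     factor 1/8. *)
  assert (Hpt : forall x, inG m x ->
    Rsum T (fun i => (s A / 2 * INR (Mk m (2 * i))) * box (shellP (2 * i)) n x)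
    <= sqrt (y x) + sqrt C).
  { intros x Hx; apply Rsum_disjoint_le.
    - pose proof (sqrt_pos (y x)); pose proof (sqrt_pos C); lra.
    - intros i Hi; set (l := (2 * i)%nat).
      pose proof (sqrt_pos (y x)); pose proof (sqrt_pos C).
      destruct (box_01 (shellP l) n x) as [[-> Hbox] | ->]; [ | lra].
      assert (Hfk : INR (Mk m l) ^ 2 / 2 <= Cnorm (fker (fun k => psi m k x) (spread m T))).
      { destruct (spread_decomp m T i Hi) as [q ->]; fold l.
        apply fker_psi_lower_bound; auto.
        - intros j Hj; specialize (Hbox j ltac:(lia)); unfold shellP in Hbox.
          rewrite (proj2 (Nat.ltb_lt j l)) in Hbox by lia; apply Nat.eqb_eq, Hbox.
        - specialize (Hbox l ltac:(lia)); unfold shellP in Hbox.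
          rewrite (proj2 (Nat.ltb_ge l l)), (proj2 (Nat.leb_le l (S l))) in Hbox by lia.
          apply Nat.eqb_neq, Bool.negb_true_iff, Hbox.
        - specialize (Hbox (S l) ltac:(lia)); unfold shellP in Hbox.
          rewrite (proj2 (Nat.ltb_ge (S l) l)), (proj2 (Nat.leb_le (S l) (S l))) in Hbox by lia.
          apply Nat.eqb_neq, Bool.negb_true_iff, Hbox.
        - apply spread_lt, hm. }
      pose proof (Cnorm_fejer_mart_ge m hm (coeffs m s) A (spread m T) x Hc Hc0 ltac:(lia)) as HF.
      rewrite <- EC in HF; fold n in HF; fold (y x) in HF.
      eapply Rle_trans; [ | apply sqrt_plus_le; [apply Cnorm_ge0 | exact HC]].
      pose proof (INR_Mk_pos m hm A) as HMA; pose proof (INR_Mk_pos m hm l) as HMl.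
      specialize (Hs A) as HsA.
      rewrite Rmult_1_r, <- (sqrt_Rsqr (s A / 2 * INR (Mk m l))) by nra.
      apply sqrt_le_1_alt; eapply Rle_trans; [ | exact HF].
      assert (Hn : INR n <= 2 * INR (Mk m A)).
      { change 2 with (INR 2); rewrite <- mult_INR; apply le_INR; unfold n; lia. }
      assert (Hn0 : 0 < INR n) by (apply lt_0_INR; unfold n; lia).
      assert (Hq : s A ^ 2 / 2 <= coeffs m s A / INR n).
      { apply Rmult_le_reg_r with (INR n); [exact Hn0 | ].
        unfold coeffs, Rdiv; rewrite (Rmult_assoc (_ * _) (/ _)), Rinv_l by lra.
        pose proof (pow2_ge_0 (s A)); nra. }
      unfold Rsqr; replace (s A / 2 * INR (Mk m l) * (s A / 2 * INR (Mk m l)))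
        with (s A ^ 2 / 2 * (INR (Mk m l) ^ 2 / 2)) by field.
      apply Rmult_le_compat; auto; [pose proof (pow2_ge_0 (s A)) | pose proof (pow2_ge_0 (INR (Mk m l)))]; lra.
    (* Disjointness for [i < j]: coordinate [2i] is nonzero on the first shell and zero on the
       second. *)
    - intros i j Hij.
      destruct (box_01 (shellP (2 * i)) n x) as [[_ Hi] | ->]; [ | left; ring].
      destruct (box_01 (shellP (2 * j)) n x) as [[_ Hj] | ->]; [ | right; ring].
      specialize (Hi (2 * i)%nat ltac:(lia)); specialize (Hj (2 * i)%nat ltac:(lia)).
      unfold shellP in Hi, Hj.
      rewrite (proj2 (Nat.ltb_ge (2 * i) (2 * i))),
        (proj2 (Nat.leb_le (2 * i) (S (2 * i)))) in Hi by lia.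
      rewrite (proj2 (Nat.ltb_lt (2 * i) (2 * j))) in Hj by lia.
      rewrite Hj in Hi; discriminate. }
  apply (integral_le m hm n) in Hpt.
  rewrite integral_plus, (integral_const m hm n (sqrt C)), integral_Rsum in Hpt.
  eapply Rle_trans; [ | exact Hpt].
  replace (s A * INR T / 8) with (Rsum T (fun _ => s A / 2 * / 4)) by (rewrite Rsum_const; field).
  apply Rsum_le; intros i Hi; rewrite integral_mul_l, Rmult_assoc.
  apply Rmult_le_compat_l; [specialize (Hs A); lra | ].
  apply integral_shell; auto; lia.
Qed.

(** * Growth of the humps and conclusion *)

Lemma ln_le x y : 0 < x -> x <= y -> ln x <= ln y.
Proof. intros Hx [H | ->]; [left; apply ln_increasing; assumption | right; reflexivity]. Qed.

Lemma ln_Mk_le m (hm : forall k, (2 <= m k)%nat) B k :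
  (forall k, (m k <= B)%nat) -> ln (INR (Mk m k)) <= INR k * ln (INR B).
Proof.
  intros HB; induction k as [ | k IH]; [simpl; rewrite ln_1; lra | ].
  pose proof (INR_m_pos m hm k); pose proof (INR_Mk_pos m hm k).
  simpl Mk; rewrite S_INR, mult_INR, ln_mult by lra.
  assert (ln (INR (m k)) <= ln (INR B)) by (apply ln_le; [lra | apply le_INR, HB]).
  lra.
Qed.

(** The hypothesis supplies large [n] of arbitrary form, and these must be replaced by the special
    indices [k = M_A + spread]. With [M_a <= n < M_{a+1}] and [A = a - 1] one has
    [k < 2 M_A <= M_a <= n], so [phi k <= phi n] by monotonicity, while [A] is still comparable to
    [ln (n + 1)] because [m] is bounded. *)
Lemma spread_index_unbounded m (hm : forall k, (2 <= m k)%nat) B phi :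
  (forall k, (m k <= B)%nat) ->
  (forall n, (1 <= n)%nat -> 1 <= phi n) ->
  (forall n n', (1 <= n)%nat -> (n <= n')%nat -> phi n <= phi n') ->
  (forall A N, exists n, (N <= n)%nat /\ (1 <= n)%nat /\ A < ln (INR n + 1) ^ 2 / phi n) ->
  forall K N, exists A, (N <= A)%nat /\
    K <= INR (A / 2) / 8 / sqrt (phi (Mk m A + spread m (A / 2))%nat).
Proof.
  intros HB Hphi Hmono Hsup K N.
  assert (HlB : 0 < ln (INR B)).
  { rewrite <- ln_1; apply ln_increasing; [lra | ].
    apply (lt_INR 1); specialize (HB 0%nat); specialize (hm 0%nat); lia. }
  (* 48 is 6 times 8: the 6 comes from [a + 1 <= 6 T], the 8 from the denominator in the goal. The
     shift by 4 below forces [A >= 3], hence [T >= 1], which [a + 1 <= 6 T] needs. *)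
  set (y := 48 * ln (INR B) * Rabs K).
  assert (Hy : 0 <= y) by (pose proof (Rabs_pos K); unfold y; nra).
  destruct (Hsup (y ^ 2) (Mk m (N + 4))) as [n [Hn [Hn1 Hlim]]].
  destruct (lvl_spec m hm n) as [Hl1 Hl2]; specialize (Hl2 Hn1).
  set (a := lvl m n) in *.
  assert (Ha : (N + 4 <= a)%nat).
  { destruct (Nat.le_gt_cases (N + 4) a) as [H | H]; [exact H | ].
    pose proof (Mk_mono m hm (S a) (N + 4) H); lia. }
  exists (a - 1)%nat; split; [lia | ].
  set (A := (a - 1)%nat); set (T := (A / 2)%nat); set (k := (Mk m A + spread m T)%nat).
  assert (HT : (2 * T <= A <= 2 * T + 1)%nat).
  { unfold T; pose proof (Nat.div_mod_eq A 2); pose proof (Nat.mod_upper_bound A 2); lia. }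
  assert (Hk1 : (1 <= k)%nat) by (pose proof (Mk_pos m hm A); unfold k; lia).
  assert (Hk : (k <= n)%nat).
  { pose proof (spread_lt m hm T); pose proof (Mk_mono m hm (2 * T) A ltac:(lia)).
    pose proof (Mk_double m hm A) as HD; replace (S A) with a in HD by (unfold A; lia).
    unfold k; lia. }
  pose proof (Hphi k Hk1) as Hpk; pose proof (Hmono k n Hk1 Hk) as Hpn.
  set (sk := sqrt (phi k)); set (sn := sqrt (phi n)).
  assert (Hsk : 0 < sk) by (apply sqrt_lt_R0; lra).
  assert (Hskn : sk <= sn) by (apply sqrt_le_1_alt, Hpn).
  set (l := ln (INR n + 1)) in *.
  assert (Hl0 : 0 <= l).
  { unfold l; rewrite <- ln_1; apply ln_le; pose proof (pos_INR n); lra. }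
  assert (Hl : l <= 6 * INR T * ln (INR B)).
  { apply Rle_trans with (INR (S a) * ln (INR B)).
    - eapply Rle_trans; [ | apply (ln_Mk_le m hm B (S a) HB)].
      unfold l; rewrite <- S_INR; apply ln_le; [apply lt_0_INR; lia | apply le_INR; lia].
    - apply Rmult_le_compat_r; [lra | ].
      replace 6 with (INR 6) by (simpl; lra); rewrite <- mult_INR; apply le_INR.
      unfold A in HT; lia. }
  assert (Hyl : y * sn <= l).
  { assert (E : phi n = sn * sn) by (symmetry; apply sqrt_sqrt; lra).
    rewrite E in Hlim; apply (Rmult_lt_compat_r (sn * sn)) in Hlim; [ | nra].
    unfold Rdiv in Hlim; rewrite (Rmult_assoc (l ^ 2)), Rinv_l, Rmult_1_r in Hlim by nra.
    destruct (Rle_lt_dec (y * sn) l) as [H | H]; [exact H | nra]. }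
  apply Rmult_le_reg_r with sk; [exact Hsk | ].
  replace (INR T / 8 / sk * sk) with (INR T / 8) by (field; lra).
  pose proof (Rle_abs K); pose proof (Rabs_pos K).
  assert (Rabs K * sk <= Rabs K * sn) by (apply Rmult_le_compat_l; lra).
  assert (48 * Rabs K * sn <= 6 * INR T).
  { apply Rmult_le_reg_l with (ln (INR B)); [exact HlB | ]; unfold y in Hyl; lra. }
  nra.
Qed.

Theorem theorem2 (m : nat -> nat)
  (hm : forall k, (2 <= m k)%nat)
  (hbounded : exists B, forall k, (m k <= B)%nat)
  (phi : nat -> R)
  (hphi1 : forall n, (1 <= n)%nat -> 1 <= phi n)
  (hmono : forall n n', (1 <= n)%nat -> (n <= n')%nat -> phi n <= phi n')
  (hlimsup : forall A N, exists n, (N <= n)%nat /\ (1 <= n)%nat /\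
                A < ln (INR n + 1) ^ 2 / phi n) :
  exists f : nat -> (nat -> nat) -> Cx,
    in_H_half m f /\
    forall A, exists n, (1 <= n)%nat /\
      A < norm_half_lvl m n (fun x => Cscal (/ phi n) (fejer m f n x)).
Proof.
  destruct hbounded as [B HB].
  destruct (sparse_weights
    (fun A => INR (A / 2) / 8 / sqrt (phi (Mk m A + spread m (A / 2))%nat))
    (fun j => INR (Mk m j) * INR (Mk m (S j)))
    (spread_index_unbounded m hm B phi HB hphi1 hmono hlimsup))
    as [s [Hs [Hs0 [Hsum Hbig]]]].
  (* At [A = 0] the growth function is 0 since [0 / 2 = 0], so the weight vanishes there. *)
  assert (H0 : s 0%nat = 0) by (apply Hs0; simpl; right; unfold Rdiv; ring).
  exists (mart m (coeffs m s)); split; [apply in_H_half_mart with B; auto | ].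
  (* A number that is at least [|a| + 1] has a square exceeding [a]; the square comes from the
     exponent in [norm_half_lvl]. *)
  intros a; destruct (Hbig (Rabs a + 1)) as [A HA].
  pose proof (integral_sqrt_fejer_ge m hm s A Hs H0) as HJ; cbv zeta in HJ.
  set (n := (Mk m A + spread m (A / 2))%nat) in *; exists n.
  assert (Hn : (1 <= n)%nat) by (pose proof (Mk_pos m hm A); unfold n; lia).
  split; [exact Hn | ]; unfold norm_half_lvl.
  specialize (hphi1 n Hn).
  set (q := sqrt (phi n)) in *.
  assert (Hq : 1 <= q) by (rewrite <- sqrt_1; apply sqrt_le_1_alt; lra).
  set (J := integral_lvl m n (fun x => sqrt (Cnorm (fejer m (mart m (coeffs m s)) n x)))) in *.
  replace (integral_lvl m n _) with (/ q * J).
  2:{ unfold J; rewrite <- integral_mul_l; apply integral_ext; auto; intros x _.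
      assert (0 < / phi n) by (apply Rinv_0_lt_compat; lra).
      rewrite Cscal_RC, Cnorm_mul, Cnorm_RC, Rabs_pos_eq, sqrt_mult by (try apply Cnorm_ge0; lra).
      rewrite sqrt_inv; reflexivity. }
  match type of HA with _ + ?u <= _ => set (C := u) in *; assert (HC : 0 <= C) by apply sqrt_pos end.
  (* After multiplication by [q >= 1] the reserve [q * C] in [HA] absorbs the error [C] from the
     earlier humps in [HJ]. *)
  assert (HJq : Rabs a + 1 <= / q * J).
  { apply Rmult_le_reg_l with q; [lra | ].
    rewrite <- Rmult_assoc, Rinv_r, Rmult_1_l by lra.
    apply (Rmult_le_compat_l q) in HA; [ | lra].
    replace (q * (s A * (INR (A / 2) / 8 / q))) with (s A * INR (A / 2) / 8) in HA by (field; lra).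
    nra. }
  pose proof (Rle_abs a); pose proof (Rabs_pos a); nra.
Qed.
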